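(* Let $n\ge2$, $k=\lfloor\frac{n+1}{2}\rfloor$, $N=k(n-1)$, $M=N$ if $n$ is even and $M=N-n+1$ if $n$ is odd. The functions on $D(GL_n)=GL_n\times GL_n$ given by $$\theta_i(X,Y)=\det X_{[n-i+1,n]}^{[n-i+1,n]},\quad i\in[n-1];$$ $$\varphi_i(X,Y)=\det U(X,Y)_{[N-i+1,N]}^{[k(n+1)-i+1,\,k(n+1)]},\quad i\in[N];$$ $$\psi_i(X,Y)=\det U(X,Y)_{[N-i+1,N]}^{[k(n+1)-i+2,\,k(n+1)+1]},\quad i\in[M],$$ form a log-canonical family with respect to the bracket $\{\cdot,\cdot\}_D$; that is, for any two functions $f,g$ in this family, $\{f,g\}_D=\omega_{f,g}\,fg$ for a constant $\omega_{f,g}$.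
   Context: Notation: $[a,b]=\{a,\dots,b\}$, $[m]=[1,m]$; $A_I^J$ is the submatrix with rows $I$ and columns $J$. $\mathcal X=[X_{[2,n]}\ 0]$, $\mathcal Y=[0\ Y_{[1,n-1]}]$ are $(n-1)\times(n+1)$ matrices, and $U(X,Y)$ is the $k\times(k+1)$ block matrix with $(n-1)\times(n+1)$ blocks whose $i$th block row has $\mathcal Y$ in block column $i$, $\mathcal X$ in block column $i+1$, and zeros elsewhere. The Poisson--Lie bracket $\{\cdot,\cdot\}_D$ on the double $D(GL_n)=GL_n\times GL_n$ associated with the Cremmer--Gervais structure is $$\{f_1,f_2\}_D=\langle R_+(E_Lf_1),E_Lf_2\rangle-\langle R_+(E_Rf_1),E_Rf_2\rangle+\langle X\nabla_Xf_1,Y\nabla_Yf_2\rangle-\langle\nabla_Xf_1\cdot X,\nabla_Yf_2\cdot Y\rangle,$$ where $\langle A,B\rangle=\mathrm{Tr}(AB)$, $\nabla_X,\nabla_Y$ are the gradients in $X$ and $Y$ with respect to this form, $E_R=X\nabla_X+Y\nabla_Y$, $E_L=\nabla_XX+\nabla_YY$, and $$R_+(\eta)=\tfrac{1}{1-\gamma_+}\eta_{>0}-\tfrac{\gamma_-}{1-\gamma_-}\eta_{\le0}+\tfrac{n-1}{2n}\mathrm{Tr}(\eta)\mathbf 1+\tfrac1n\big(\mathrm{Tr}(\eta)D_n-\mathrm{Tr}(D_n\eta)\mathbf 1\big);$$ here $A_{>0}$ is the strictly upper triangular part and $A_{\le0}$ the lower triangular part including the diagonal, $S=e_{12}+\dots+e_{n-1,n}$,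 $\gamma_+(A)=SAS^T$, $\gamma_-(A)=S^TAS$, $D_n=\mathrm{diag}(1,\dots,n)$, $\mathbf 1$ the identity. *)

(* Defs.v *)
From HB Require Import structures.
From mathcomp Require Import all_boot all_order all_algebra.
From mathcomp Require Import boolp classical_sets topology normedtype derive.

Set Implicit Arguments.
Unset Strict Implicit.
Unset Printing Implicit Defensive.

Import Order.TTheory GRing.Theory Num.Theory.
Import numFieldNormedType.Exports.

Local Open Scope classical_set_scope.
Local Open Scope ring_scope.

(* The ground field is an arbitrary numFieldType: this covers the real and the
   complex numbers.  A function on D(GL_n) = GL_n x GL_n is represented by its
   defining formula on pairs of n x n matrices; GL_n being open, gradients at
   invertible matrices only depend on the restriction to GL_n x GL_n. *)
Definition dfun (K : numFieldType) (n : nat) := 'M[K]_n -> 'M[K]_n -> K.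

Section PoissonBracket.
Variables (K : numFieldType) (n : nat).
Implicit Types (A B X Y eta : 'M[K]_n) (f : dfun K n).

Definition trform A B : K := \tr (A *m B).

(* Gradients with respect to the trace form, i.e. the matrices such that
   trform (gradX f X Y) Z is the derivative of f in X along Z; since
   trform A (delta_mx j i) = A i j, the (i, j) entry is d f / d x_{j,i}. *)
Definition gradX f X Y : 'M[K]_n :=
  \matrix_(i, j) 'D_(delta_mx j i) ((fun Z => f Z Y) : 'M[K]_n -> K^o) X.
Definition gradY f X Y : 'M[K]_n :=
  \matrix_(i, j) 'D_(delta_mx j i) ((fun Z => f X Z) : 'M[K]_n -> K^o) Y.

Definition gradL f X Y := gradX f X Y *m X + gradY f X Y *m Y.
Definition gradR f X Y := X *m gradX f X Y + Y *m gradY f X Y.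

Definition shift_mx : 'M[K]_n := \matrix_(i, j) (j == i.+1 :> nat)%:R.
Definition gammap A := shift_mx *m A *m shift_mx^T.
Definition gammam A := shift_mx^T *m A *m shift_mx.

(* 1 / (1 - g) for an operator g with g ^ n = 0, as the finite geometric sum. *)
Definition geom (g : 'M[K]_n -> 'M[K]_n) A := \sum_(m < n) iter m g A.

Definition upper_part A : 'M[K]_n :=
  \matrix_(i, j) if (i < j)%N then A i j else 0.
Definition lower_part A : 'M[K]_n :=
  \matrix_(i, j) if (j <= i)%N then A i j else 0.

Definition D_mx : 'M[K]_n := diag_mx (\row_(j < n) j.+1%:R).

Definition Rplus eta : 'M[K]_n :=
  geom gammap (upper_part eta)
  - gammam (geom gammam (lower_part eta))
  + (n%:R - 1) / (2 * n%:R) * \tr eta *: 1%:M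
  + n%:R^-1 *: (\tr eta *: D_mx - \tr (D_mx *m eta) *: 1%:M).

Definition bracketD f1 f2 : dfun K n := fun X Y =>
  trform (Rplus (gradL f1 X Y)) (gradL f2 X Y)
  - trform (Rplus (gradR f1 X Y)) (gradR f2 X Y)
  + trform (X *m gradX f1 X Y) (Y *m gradY f2 X Y)
  - trform (gradX f1 X Y *m X) (gradY f2 X Y *m Y).

Definition log_canonical (F : set (dfun K n)) : Prop :=
  forall f g, F f -> F g ->
  exists omega : K, forall X Y, X \in unitmx -> Y \in unitmx ->
    bracketD f g X Y = omega * (f X Y * g X Y).

(* geom is the inverse of 1 - g for both operators g it is used with. *)
Lemma gammapB A B : gammap (A - B) = gammap A - gammap B.
Proof. by rewrite /gammap mulmxBr mulmxBl. Qed.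

Lemma gammamB A B : gammam (A - B) = gammam A - gammam B.
Proof. by rewrite /gammam mulmxBr mulmxBl. Qed.

Lemma iter_gammap A : iter n gammap A = 0.
Proof.
have H m (i j : 'I_n) : (n <= i + m)%N -> iter m gammap A i j = 0.
  elim: m i j => [|m IH] i j; first by rewrite addn0 leqNgt ltn_ord.
  rewrite addnS => le_n; rewrite iterS /gammap -mulmxA mxE big1 // => l _.
  rewrite !mxE; case: eqP => [eq_l|]; last by rewrite mul0r.
  by rewrite mul1r big1 // => q _; rewrite IH ?mul0r // eq_l addSn.
by apply/matrixP => i j; rewrite mxE H // leq_addl.
Qed.

Lemma iter_gammam A : iter n gammam A = 0.
Proof.
have H m (i j : 'I_n) : (i < m)%N -> iter m gammam A i j = 0.
  elim: m i j => [//|m IH] i j lt_im.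
  rewrite iterS /gammam -mulmxA mxE big1 // => l _.
  rewrite !mxE; case: eqP => [eq_l|]; last by rewrite mul0r.
  rewrite mul1r big1 // => q _; rewrite IH ?mul0r //.
  by rewrite -ltnS -eq_l.
by apply/matrixP => i j; rewrite mxE H.
Qed.

Lemma geomK (g : 'M[K]_n -> 'M[K]_n) :
  (forall A B, g (A - B) = g A - g B) -> (forall A, iter n g A = 0) ->
  forall A, geom g A - g (geom g A) = A /\ geom g (A - g A) = A.
Proof.
move=> gB g0 A.
have gz : g 0 = 0 by have := gB 0 0; rewrite !subrr.
have gN B : g (- B) = - g B by rewrite -sub0r gB gz sub0r.
have gD B C : g (B + C) = g B + g C by rewrite -{1}[C]opprK gB gN opprK.
have iB m B C : iter m g (B - C) = iter m g B - iter m g C.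
  by elim: m => //= m ->; rewrite gB.
have tel : \sum_(m < n) (iter m g A - iter m.+1 g A) = A.
  rewrite -(big_mkord xpredT (fun m => iter m g A - iter m.+1 g A)).
  under eq_bigr do rewrite -opprB.
  by rewrite sumrN telescope_sumr // g0 sub0r opprK.
split; last first.
  rewrite -[RHS]tel /geom; apply: eq_bigr => m _.
  by rewrite iB iterSr.
rewrite -[RHS]tel /geom (big_morph g gD gz) -sumrB.
by apply: eq_bigr => m _; rewrite iterS.
Qed.

Lemma geom_gammapK A :
  geom gammap A - gammap (geom gammap A) = A /\ geom gammap (A - gammap A) = A.
Proof. exact: geomK gammapB iter_gammap A. Qed.

Lemma geom_gammamK A :
  geom gammam A - gammam (geom gammam A) = A /\ geom gammam (A - gammam A) = A.
Proof. exact: geomK gammamB iter_gammam A. Qed.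

End PoissonBracket.

(* Entry of A in row r and column c, with rows and columns numbered from 1;
   0 when r or c exceeds the size of A. *)
Definition mxat (K : numFieldType) (m p : nat) (A : 'M[K]_(m, p)) (r c : nat) :
    K :=
  if (insub r.-1, insub c.-1) is (Some i, Some j) then A i j else 0.

(* det A_{[r, r + i - 1]}^{[c, c + i - 1]}, indices starting from 1. *)
Definition minor (K : numFieldType) (m p : nat) (A : 'M[K]_(m, p))
    (r c i : nat) : K :=
  \det (\matrix_(s < i, t < i) mxat A (r + s)%N (c + t)%N).

Section Family.
Variables (K : numFieldType) (n : nat).
Implicit Types (X Y : 'M[K]_n).

(* [X_{[2,n]} 0] and [0 Y_{[1,n-1]}] *)
Definition calX X : 'M[K]_(n.-1, n.+1) :=
  \matrix_(i, j) if (j < n)%N then mxat X i.+2 j.+1 else 0.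
Definition calY Y : 'M[K]_(n.-1, n.+1) :=
  \matrix_(i, j) if (0 < j)%N then mxat Y i.+1 j else 0.

Definition CGk : nat := ((n + 1)./2)%N.
Definition CGN : nat := (CGk * n.-1)%N.
Definition CGM : nat := if odd n then (CGN - n + 1)%N else CGN.

Definition U_mx X Y : 'M[K]_(\sum_(a < CGk) n.-1, \sum_(b < CGk.+1) n.+1) :=
  \mxblock_(a < CGk, b < CGk.+1)
    (if b == a :> nat then calY Y
     else if b == a.+1 :> nat then calX X else 0).

Definition theta (i : nat) : dfun K n := fun X Y =>
  minor X (n - i + 1)%N (n - i + 1)%N i.
Definition phi (i : nat) : dfun K n := fun X Y =>
  minor (U_mx X Y) (CGN - i + 1)%N (CGk * (n + 1) - i + 1)%N i.
Definition psi (i : nat) : dfun K n := fun X Y =>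
  minor (U_mx X Y) (CGN - i + 1)%N (CGk * (n + 1) - i + 2)%N i.

Definition CGfamily : set (dfun K n) :=
  [set f | [\/ exists2 i, (1 <= i <= n.-1)%N & f = theta i,
               exists2 i, (1 <= i <= CGN)%N & f = phi i
             | exists2 i, (1 <= i <= CGM)%N & f = psi i]].

End Family.

(* Main.v *)
(* Write a = X grad_X f, b = Y grad_Y f, c = grad_X f X, d = grad_Y f Y, with
   primes for g.  Every function of the family is a minor of the block
   bidiagonal matrix U, hence semi-invariant under the upper triangular left
   and the lower triangular right multiplications of U that preserve its block
   structure.  Infinitesimally: gammap a + b is upper triangular (outside its
   last row), gammap c + d is lower triangular, and their diagonals are constant
   multiples of f.  Summing by parts in the geometric series of R_+ then leaves,
   modulo constant multiples of f g and because <c, c'> = <a, a'>, only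
     - <(c + gammam d)_{<=0}, c'> - <gammap a + b, b'>.
   Let G be the adjugate of the submatrix of U defining f, placed at the
   transposed position, and H the same for g.  The remaining expression is a sum
   of traces of products of blocks of G U, U G, H and U, which splits according
   to the shift between the blocks of G and of H.  If the shifted window of g
   starts inside that of f, then G U and U G act on the blocks of H as f times the
   identity.  If instead it ends before that of f, the triangularity of U H and
   G U lets one slide along the diagonal of U until H vanishes. *)

Require Import Defs.
From mathcomp Require Import all_boot all_order all_algebra.
From mathcomp Require Import boolp classical_sets functions topology normedtype derive.
From mathcomp Require Import perm zify ring.
Set Implicit Arguments.
Unset Strict Implicit.
Unset Printing Implicit Defensive.
Import GRing.Theory.
Import numFieldNormedType.Exports.
Local Open Scope classical_set_scope.
Local Open Scope ring_scope.

(** * Functions proportional to a given one *)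

Section Proportional.
Variables (K : numFieldType) (T : Type).
Implicit Types (f g h k : T -> K).

(** One constant serves all points, and no division occurs, so [f] may vanish. *)
Definition propto f h := exists w, forall t, h t = w * f t.

Lemma eq_propto f h k : h =1 k -> propto f h -> propto f k.
Proof. by move=> hk [w hw]; exists w => t; rewrite -hk. Qed.

Lemma propto0 f : propto f (fun=> 0).
Proof. by exists 0 => t; rewrite mul0r. Qed.

Lemma propto_refl f : propto f f.
Proof. by exists 1 => t; rewrite mul1r. Qed.

Lemma proptoD f h k : propto f h -> propto f k -> propto f (fun t => h t + k t).
Proof. by move=> [w hw] [v kv]; exists (w + v) => t; rewrite hw kv mulrDl. Qed.

Lemma proptoZ f h c : propto f h -> propto f (fun t => c * h t).
Proof. by move=> [w hw]; exists (c * w) => t; rewrite hw mulrA. Qed.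

Lemma proptoN f h : propto f h -> propto f (fun t => - h t).
Proof. by move=> [w hw]; exists (- w) => t; rewrite hw mulNr. Qed.

Lemma proptoB f h k : propto f h -> propto f k -> propto f (fun t => h t - k t).
Proof. by move=> fh fk; apply: proptoD => //; apply: proptoN. Qed.

Lemma proptoMn f h m : propto f h -> propto f (fun t => h t *+ m).
Proof. by move=> [w hw]; exists (w *+ m) => t; rewrite hw mulrnAl. Qed.

Lemma propto_sum f (I : Type) (s : seq I) (P : pred I) (h : I -> T -> K) :
  (forall i, P i -> propto f (h i)) ->
  propto f (fun t => \sum_(i <- s | P i) h i t).
Proof.
move=> fh; elim: s => [|i s IH].
  by apply: eq_propto (propto0 f) => t; rewrite big_nil.
have [Pi|nPi] := boolP (P i); last first.
  by apply: eq_propto IH => t; rewrite big_cons (negbTE nPi).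
by apply: eq_propto (proptoD (fh _ Pi) IH) => t; rewrite big_cons Pi.
Qed.

Lemma proptoM f g h k : propto f h -> propto g k ->
  propto (fun t => f t * g t) (fun t => h t * k t).
Proof. by move=> [w hw] [v kv]; exists (w * v) => t; rewrite hw kv mulrACA. Qed.

End Proportional.

Lemma block_lt p a b (i j : 'I_p) : (a < b)%N -> (a * p + i < b * p + j)%N.
Proof.
move=> lt_ab; apply: (@leq_trans (a.+1 * p)).
  by rewrite mulSn addnC ltn_add2r.
by rewrite (leq_trans _ (leq_addr _ _)) // leq_mul2r lt_ab orbT.
Qed.

Lemma block_eq p a b (i j : 'I_p) :
  (a * p + i == b * p + j)%N = (a == b) && (i == j).
Proof.
have [ab|ab|<-] := ltngtP a b; last by rewrite eqn_add2l.
  by rewrite ltn_eqF ?block_lt.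
by rewrite gtn_eqF ?block_lt.
Qed.

(** * Adjugates of windows of a block bidiagonal matrix *)

Section Blocks.
Variables (K : numFieldType) (p q : nat).
Implicit Types (x y : 'M[K]_(p, q)) (G H : nat -> nat -> 'M[K]_(q, p)).

(* G a b is the block in block row a and block column b of a matrix placed against
   the infinite matrix U with diagonal blocks y and superdiagonal blocks x.  Then
   rowprod a b is the block (a, b) of U G, while colprod a b is the block
   (a, b + 1) of G U. *)
Definition rowprod x y G a b := y *m G a b + x *m G a.+1 b.
Definition colprod x y G a b := G a b.+1 *m y + G a b *m x.

(* The identities satisfied by the adjugate of the submatrix of U with rows
   [r, r + m) and columns [s, s + m), f being the determinant. *)
Record adj_blocks x y (r s m : nat) (f : K) G : Prop := AdjBlocks {
  adj_col0 : forall a b (i : 'I_q) (j : 'I_p),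
    ~~ (s <= a * q + i < s + m)%N -> G a b i j = 0;
  adj_row0 : forall a b (i : 'I_q) (j : 'I_p),
    ~~ (r <= b * p + j < r + m)%N -> G a b i j = 0;
  adj_rowprod : forall a b (i j : 'I_p), (r <= a * p + i < r + m)%N ->
    rowprod x y G a b i j = f *+ (a * p + i == b * p + j)%N;
  adj_colprod : forall a b (i j : 'I_q), (s <= b.+1 * q + j < s + m)%N ->
    colprod x y G a b i j = f *+ (a * q + i == b.+1 * q + j)%N }.

(** * Triangularity of the products of [U] with one adjugate *)

Section OneFamily.
Variables (x y : 'M[K]_(p, q)) (r s m k : nat) (f : K).
Variable G : nat -> nat -> 'M[K]_(q, p).
Hypothesis adjG : adj_blocks x y r s m f G.

Lemma colprod_row0 a b (i j : 'I_q) :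
  ~~ (s <= a * q + i < s + m)%N -> colprod x y G a b i j = 0.
Proof.
move=> out; rewrite !mxE !big1 ?addr0 // => l _.
  by rewrite (adj_col0 adjG) ?mul0r.
by rewrite (adj_col0 adjG) ?mul0r.
Qed.

Lemma rowprod_col0 a b (i j : 'I_p) :
  ~~ (r <= b * p + j < r + m)%N -> rowprod x y G a b i j = 0.
Proof.
move=> out; rewrite !mxE !big1 ?addr0 // => l _.
  by rewrite (adj_row0 adjG) ?mulr0.
by rewrite (adj_row0 adjG) ?mulr0.
Qed.

Lemma colprod_diag a (i : 'I_q) :
  colprod x y G a.+1 a i i = f *+ (s <= a.+1 * q + i < s + m)%N.
Proof.
have [in_s|out] := boolP (s <= _ < _)%N; last by rewrite colprod_row0.
by rewrite (adj_colprod adjG) ?eqxx.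
Qed.

Lemma rowprod_diag a (i : 'I_p) :
  rowprod x y G a a i i = f *+ (r <= a * p + i < r + m)%N.
Proof.
have [in_r|out] := boolP (r <= _ < _)%N; last by rewrite rowprod_col0.
by rewrite (adj_rowprod adjG) ?eqxx.
Qed.

(** Either row [i] is outside the window and is zero, or the later column [j] is inside it as well,
    and there [G U] is [f] times the identity. *)
Lemma colprod_diag_upper a (i j : 'I_q) :
  (i < j)%N -> (a.+1 * q + j < s + m)%N -> colprod x y G a.+1 a i j = 0.
Proof.
move=> ij je; have [/andP[si ie]|out] := boolP (s <= a.+1 * q + i < s + m)%N.
  by rewrite (adj_colprod adjG) ?block_eq ?eqxx ?[i == j]ltn_eqF //= je; lia.
by rewrite colprod_row0.
Qed.

Lemma adj_col_eq0 a b : (s + m <= a * q)%N -> G a b = 0.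
Proof.
by move=> ea; apply/matrixP => i j; rewrite (adj_col0 adjG) ?mxE //; lia.
Qed.

Lemma colprod_above a b : (a <= b)%N -> (b.+2 * q <= s + m)%N ->
  colprod x y G a b = 0.
Proof.
move=> ab be; apply/matrixP => i j; rewrite [RHS]mxE.
have [/andP[si ie]|out] := boolP (s <= a * q + i < s + m)%N; last first.
  by rewrite colprod_row0.
have ij := @block_lt q a b.+1 i j ab.
rewrite (adj_colprod adjG) ?ltn_eqF //.
by have := ltn_ord j; rewrite mulSn in be; lia.
Qed.

Hypothesis rmE : (r + m = k * p)%N.

(** A nonzero column [j] of [U G] lies in the row window. That window runs to the end of block row
    [k - 1], so the lower row [i] lies in it too, and there [U G] is [f] times the identity. *)
Lemma rowprod_diag_lower a (i j : 'I_p) :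
  (j < i)%N -> rowprod x y G a a i j = 0.
Proof.
move=> ji; have [/andP[ri ie]|] := boolP (r <= a * p + j < r + m)%N; last first.
  exact: rowprod_col0.
rewrite (adj_rowprod adjG) ?block_eq ?eqxx ?[i == j]gtn_eqF //=.
rewrite (leq_trans ri) ?leq_add2l ?(ltnW ji) //= rmE.
have ak : (a < k)%N.
  by rewrite ltnNge; apply/negP => ka; have := leq_mul ka (leqnn p); lia.
by have := leq_mul ak (leqnn p); have := ltn_ord i; lia.
Qed.

Lemma adj_row_eq0 a b : (k <= b)%N -> G a b = 0.
Proof.
move=> kb; apply/matrixP => i j; rewrite (adj_row0 adjG) ?mxE // rmE.
by have := leq_mul kb (leqnn p); lia.
Qed.

(** Imposed separately because [adj_rowprod] says nothing about rows below the window. *)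
Hypothesis below : forall a b (i j : 'I_p),
  (k <= a)%N -> rowprod x y G a b i j = 0.

Lemma rowprod_lower a b : (b < a)%N -> rowprod x y G a b = 0.
Proof.
move=> ba; apply/matrixP => i j; rewrite [RHS]mxE.
have [ka|ak] := leqP k a; first exact: below.
have [in_r|] := boolP (r <= b * p + j < r + m)%N; last first.
  exact: rowprod_col0.
have ba' := block_lt i j; have := block_lt j i ba => ji.
rewrite (adj_rowprod adjG) ?block_eq ?gtn_eqF //=.
rewrite (leq_trans _ (ltnW ji)) /= ?rmE; last by case/andP: in_r.
by have := leq_mul ak (leqnn p); have := ltn_ord i; lia.
Qed.

End OneFamily.

Lemma trace_triangular n (A B : 'M[K]_n) :
  (forall i j : 'I_n, (j < i)%N -> A i j = 0) ->
  (forall i j : 'I_n, (j < i)%N -> B i j = 0) ->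
  \tr (A *m B) = \sum_i A i i * B i i.
Proof.
move=> A0 B0; apply: eq_bigr => i _; rewrite mxE (bigD1 i) //= big1 ?addr0 //.
move=> j ji; have [ij|ij|/val_inj ij] := ltngtP i j.
- by rewrite B0 ?mulr0.
- by rewrite A0 ?mul0r.
- by rewrite ij eqxx in ji.
Qed.

(** Agreement of [A] with a scalar matrix is only required where the transposed entry of [B] can be
    nonzero; this is how [G U] and [U G] act as [f] on the support of [H]. *)
Lemma trace_scalar_like n (A B : 'M[K]_n) c :
  (forall i j : 'I_n, A i j * B j i = c *+ (i == j) * B j i) ->
  \tr (A *m B) = c * \tr B.
Proof.
move=> AB; rewrite /mxtrace mulr_sumr; apply: eq_bigr => i _.
rewrite mxE (bigD1 i) //= big1 ?addr0 ?AB ?eqxx // => j ji.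
by rewrite AB eq_sym (negbTE ji) mul0r.
Qed.

(** * Traces of single block products *)

Section TracePropto.
Variables (T : Type) (x y : T -> 'M[K]_(p, q)) (r s m : nat) (f : T -> K).
Variable G : T -> nat -> nat -> 'M[K]_(q, p).
Hypothesis adjG : forall t, adj_blocks (x t) (y t) r s m (f t) (G t).
Hypothesis qs : (q <= s)%N.

(** The traces of [(U G)_{l,l}] and of the diagonal blocks of [G U] are multiples of [f], and each
    is a sum of two consecutive traces of the chain [y G_{0,0}], [x G_{1,0}], [y G_{1,1}], ... The
    chain starts at 0 because [q <= s] forces [G_{0,0} = 0]. *)
Lemma propto_trace l :
  propto f (fun t => \tr (y t *m G t l l)) /\
  propto f (fun t => \tr (x t *m G t l.+1 l)).
Proof.
have row l' : propto f (fun t => \tr (rowprod (x t) (y t) (G t) l' l')).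
  apply: propto_sum => i _.
  apply: eq_propto (proptoMn _ (propto_refl f)) => t.
  by rewrite (rowprod_diag (adjG t)).
have step l' : propto f (fun t => \tr (y t *m G t l' l')) ->
    propto f (fun t => \tr (x t *m G t l'.+1 l')).
  move=> yG; apply: eq_propto (proptoB (row l') yG) => t.
  by rewrite /rowprod mxtraceD addrAC subrr add0r.
elim: l => [|l [_ IH]]; last first.
  suff yG : propto f (fun t => \tr (y t *m G t l.+1 l.+1)) by split; auto.
  have col : propto f (fun t => \tr (colprod (x t) (y t) (G t) l.+1 l)).
    apply: propto_sum => i _.
    apply: eq_propto (proptoMn _ (propto_refl f)) => t.
    by rewrite (colprod_diag (adjG t)).
  apply: eq_propto (proptoB col IH) => t.
  by rewrite /colprod mxtraceD mxtrace_mulC [\tr (G t _ _ *m x t)]mxtrace_mulC addrK.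
suff yG : propto f (fun t => \tr (y t *m G t 0%N 0%N)) by split; auto.
apply: eq_propto (propto0 f) => t; rewrite (_ : G t 0%N 0%N = 0) ?mulmx0 ?mxtrace0 //.
apply/matrixP => i j; rewrite (adj_col0 (adjG t)) ?mxE // mul0n.
by have := ltn_ord i; lia.
Qed.

End TracePropto.

(** * The cross term of two windows, block by block *)

Section TwoFamilies.
Variables (T : Type) (x y : T -> 'M[K]_(p, q)) (k r s m r' s' m' : nat).
Variables (f g : T -> K) (G H : T -> nat -> nat -> 'M[K]_(q, p)).
Hypothesis y0 : forall t i (j : 'I_q), j = 0%N :> nat -> y t i j = 0.
Hypothesis adjG : forall t, adj_blocks (x t) (y t) r s m (f t) (G t).
Hypothesis adjH : forall t, adj_blocks (x t) (y t) r' s' m' (g t) (H t).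
Hypotheses (rmE : (r + m = k * p)%N) (rmE' : (r' + m' = k * p)%N).
Hypotheses (smE : (k * q <= s + m <= (k * q).+1)%N).
Hypotheses (smE' : (k * q <= s' + m' <= (k * q).+1)%N).
Hypotheses (belowH : forall t a b (i j : 'I_p), (k <= a)%N ->
  rowprod (x t) (y t) (H t) a b i j = 0).
Hypotheses (q_gt0 : (0 < q)%N) (qs : (q <= s)%N) (qs' : (q <= s')%N).
Hypotheses (rr' : (r <= r')%N) (ss' : (s <= s')%N).

Let fg t := f t * g t.

(** Moving a row of the second window down from block [l] to block [a < k] keeps it after [r' >= r]
    and before [k * p], hence inside the first window, where [U G] is [f] times the identity. *)
Lemma propto_inner_row a l : (l <= a)%N ->
  propto fg (fun t => \tr (rowprod (x t) (y t) (G t) a a *m (y t *m H t l l))).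
Proof.
move=> la; have [ak|ka] := ltnP a k; last first.
  apply: eq_propto (propto0 _) => t.
  by rewrite /rowprod !(adj_row_eq0 (adjG t) rmE) // !mulmx0 addr0 mul0mx mxtrace0.
have [yH _] := propto_trace adjH qs' l.
apply: eq_propto (proptoM (propto_refl f) yH) => t.
rewrite (trace_scalar_like (c := f t)) // => i j.
have [in_r|out] := boolP (r' <= l * p + i < r' + m')%N; last first.
  have -> : (y t *m H t l l) j i = 0.
    by rewrite mxE big1 // => u _; rewrite (adj_row0 (adjH t)) ?mulr0.
  by rewrite !mulr0.
rewrite (adj_rowprod (adjG t)) ?block_eq ?eqxx // rmE.
have := leq_mul la (leqnn p); have := leq_mul ak (leqnn p).
by have := ltn_ord i; lia.
Qed.

Lemma propto_inner_col a l : (l <= a)%N ->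
  propto fg (fun t => \tr (lower_part (colprod (x t) (y t) (G t) a.+1 a)
                           *m (H t l.+1 l *m x t))).
Proof.
move=> la; have la' : (l.+1 * q <= a.+1 * q)%N by rewrite leq_mul2r ltnS la orbT.
have Hx0 t (i j : 'I_q) : ~~ (s' <= l.+1 * q + j < s' + m')%N ->
    (H t l.+1 l *m x t) j i = 0.
  by move=> out; rewrite mxE big1 // => u _; rewrite (adj_col0 (adjH t)) ?mul0r.
have [full|part] := leqP (a.+2 * q) (s + m).
  have [_ xH] := propto_trace adjH qs' l.
  apply: eq_propto (proptoM (propto_refl f) xH) => t.
  rewrite [\tr (x t *m _)]mxtrace_mulC.
  rewrite (trace_scalar_like (c := f t)) // => i j.
  have [in_s|out] := boolP (s' <= l.+1 * q + j < s' + m')%N; last first.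
    by rewrite Hx0 // !mulr0.
  rewrite mxE (adj_colprod (adjG t)) ?block_eq ?eqxx /=; last first.
    by rewrite mulSn in full; have := ltn_ord j; lia.
  by have [->|] := eqVneq i j; rewrite ?leqnn ?mulr0n ?if_same.
(* Here the first window ends inside block [a + 1], at most one column into it, so the lower part of
   [G U] reduces to its [(0, 0)] entry. The facing entry of [H x] is a diagonal entry of [H U],
   since column 0 of [y] vanishes. *)
pose i0 := Ordinal q_gt0.
have Hx00 : propto g (fun t => (H t l.+1 l *m x t) i0 i0).
  apply: eq_propto (proptoMn (s' <= l.+1 * q + i0 < s' + m')%N
                             (propto_refl g)) => t.
  rewrite -(colprod_diag (adjH t)) mxE [X in X + _]mxE big1 ?add0r // => u _.
  by rewrite y0 ?mulr0.
have GU00 : propto f (fun t => colprod (x t) (y t) (G t) a.+1 a i0 i0).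
  apply: eq_propto (proptoMn _ (propto_refl f)) => t.
  by rewrite (colprod_diag (adjG t)).
apply: eq_propto (proptoM GU00 Hx00) => t.
have ka : (k <= a.+1)%N.
  rewrite leqNgt; apply/negP => ak; have := leq_mul ak (leqnn q).
  by case/andP: smE; lia.
have low (i j : 'I_q) : lower_part (colprod (x t) (y t) (G t) a.+1 a) i j =
    if (i == i0) && (j == i0) then colprod (x t) (y t) (G t) a.+1 a i0 i0 else 0.
  rewrite mxE; case: leqP => [ji|ij]; last first.
    by case: andP => // -[/eqP ii /eqP jj]; rewrite ii jj in ij.
  have [i_0|i_gt0] := posnP i.
    have -> : i = i0 by apply: val_inj.
    have -> : j = i0 by apply: val_inj => /=; move: ji; rewrite i_0 leqn0 => /eqP.
    by rewrite eqxx.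
  rewrite [i == i0]gtn_eqF //= (colprod_row0 (adjG t)) //.
  by have := leq_mul ka (leqnn q); lia.
rewrite /mxtrace (bigD1 i0) //= [X in _ + X]big1 => [|i i_i0].
  rewrite addr0 [RHS]mxE (bigD1 i0) //= big1 ?addr0 ?low ?eqxx // => j j_i0.
  by rewrite low (negbTE j_i0) andbF mul0r.
by rewrite mxE big1 // => j _; rewrite low (negbTE i_i0) mul0r.
Qed.

(* Since (U H)_{j + d + 1, b} = 0 and (G U)_{c, j + 1} = 0, the product is unchanged
   when j increases, and H vanishes far enough to the right. *)
Lemma adj_swap_eq0 t c j d b : (c <= j)%N -> (b < j + d.+1)%N ->
  G t c j *m y t *m H t (j + d.+1)%N b = 0.
Proof.
have colH j' : (k <= j')%N -> H t (j' + d.+1)%N b = 0.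
  move=> kj; apply: (adj_col_eq0 (adjH t)).
  by have := leq_mul kj (leqnn q); rewrite mulnDl mulSn; lia.
move: {-1}(k - j)%N (leqnn (k - j)%N) => u; elim: u j => [|u IH] j ku cj bj.
  by rewrite colH ?mulmx0 //; lia.
have := rowprod_lower (adjH t) rmE' (@belowH t) bj.
move/eqP; rewrite addr_eq0 => /eqP yH; rewrite -mulmxA yH mulmxN mulmxA.
have GU : colprod (x t) (y t) (G t) c j *m H t (j + d.+1).+1 b = 0.
  have [kj|jk] := leqP k j.+1; first by rewrite -addSn colH ?mulmx0.
  rewrite (colprod_above (adjG t)) ?mul0mx //.
  by have := leq_mul jk (leqnn q); lia.
move: GU; rewrite mulmxDl => /eqP; rewrite addrC addr_eq0 => /eqP ->.
by rewrite opprK -addSn IH //; lia.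
Qed.

(** Up to products killed by [adj_swap_eq0], cyclicity of the trace turns the first term into the
    trace of [(U G)_{a,a} x H_{l+1,l}]. The sum becomes the trace of [(U G)_{a,a} (U H)_{l,l}], a
    product of two upper triangular matrices with constant multiples of [f] and [g] on their
    diagonals. *)
Lemma propto_outer a l : (a < l)%N ->
  propto fg (fun t =>
    \tr (lower_part (colprod (x t) (y t) (G t) a.+1 a) *m (H t l.+1 l *m x t))
    + \tr (rowprod (x t) (y t) (G t) a a *m (y t *m H t l l))).
Proof.
move=> al; have [d lE] : exists d, l = (a + d.+1)%N by exists (l - a).-1; lia.
have diag : propto fg (fun t => \tr (rowprod (x t) (y t) (G t) a a
                                      *m rowprod (x t) (y t) (H t) l l)).
  pose F i t := rowprod (x t) (y t) (G t) a a i i *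
                rowprod (x t) (y t) (H t) l l i i.
  have pr i : propto fg (F i).
    apply: proptoM.
      apply: eq_propto (proptoMn _ (propto_refl f)) => t.
      by rewrite (rowprod_diag (adjG t)).
    apply: eq_propto (proptoMn _ (propto_refl g)) => t.
    by rewrite (rowprod_diag (adjH t)).
  have prF := propto_sum (index_enum 'I_p) (P := xpredT) (fun i _ => pr i).
  apply: eq_propto prF => t; rewrite trace_triangular //.
    exact: rowprod_diag_lower (adjG t) rmE _.
  exact: rowprod_diag_lower (adjH t) rmE' _.
apply: eq_propto diag => t.
(* Above the diagonal, [G U] vanishes in columns before the end of the first window; for a later
   column, the facing row of [H], in block [l + 1 > a + 1], is past the end of the second window. *)
have -> : \tr (lower_part (colprod (x t) (y t) (G t) a.+1 a) *m (H t l.+1 l *m x t))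
    = \tr (colprod (x t) (y t) (G t) a.+1 a *m (H t l.+1 l *m x t)).
  apply: eq_bigr => i _; rewrite !mxE; apply: eq_bigr => j _; rewrite [X in X * _]mxE.
  case: leqP => // ij; rewrite mul0r.
  have [je|ej] := ltnP (a.+1 * q + j) (s + m).
    by rewrite (colprod_diag_upper (adjG t)) ?mul0r.
  rewrite [X in _ * X]mxE big1 ?mulr0 // => u _.
  rewrite (adj_col0 (adjH t)) ?mul0r //.
  have := leq_mul (al : a.+2 <= l.+1)%N (leqnn q); rewrite mulSn; lia.
have e1 : G t a.+1 a.+1 *m y t *m H t l.+1 l = 0.
  by rewrite lE -addSn adj_swap_eq0 //; lia.
(* The term [G_{a,a+1} y H], itself zero by sliding, completes [G x] to a block of [G U] above the
   diagonal. *)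
have e2 : G t a a *m x t *m H t l.+1 l = 0.
  have -> : G t a a *m x t *m H t l.+1 l =
      colprod (x t) (y t) (G t) a a *m H t l.+1 l.
    by rewrite mulmxDl lE -addSn adj_swap_eq0 ?add0r //; lia.
  have [ka|ak] := leqP k a.+1.
    rewrite (adj_col_eq0 (adjH t)) ?mulmx0 //.
    have := leq_mul (al : a.+2 <= l.+1)%N (leqnn q); have := leq_mul ka (leqnn q).
    by rewrite [(a.+2 * q)%N]mulSn; lia.
  rewrite (colprod_above (adjG t)) ?mul0mx //.
  by have := leq_mul ak (leqnn q); lia.
have e3 : \tr (rowprod (x t) (y t) (G t) a a *m (x t *m H t l.+1 l)) =
          \tr (colprod (x t) (y t) (G t) a.+1 a *m (H t l.+1 l *m x t)).
  rewrite !mulmxDl !mxtraceD; congr (_ + _).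
    rewrite -mulmxA [G t a a *m _]mulmxA e2 mulmx0 mxtrace0.
    by rewrite mulmxA e1 mul0mx mxtrace0.
  by rewrite -[LHS]/(\tr _) -mulmxA [LHS]mxtrace_mulC !mulmxA.
by rewrite -e3 -mxtraceD -mulmxDr addrC.
Qed.

Lemma propto_cross a l :
  propto fg (fun t =>
    \tr (lower_part (colprod (x t) (y t) (G t) a.+1 a) *m (H t l.+1 l *m x t))
    + \tr (rowprod (x t) (y t) (G t) a a *m (y t *m H t l l))).
Proof.
have [al|la] := ltnP a l; first exact: propto_outer.
exact: proptoD (propto_inner_col la) (propto_inner_row la).
Qed.

End TwoFamilies.

End Blocks.

(** * The Cremmer-Gervais bracket *)

Section CremmerGervais.
Variables (K : numFieldType) (n : nat).
Implicit Types (A B C : 'M[K]_n).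

(** * The shifts [gammap] and [gammam] entry by entry *)

Lemma gammapE A (i j i' j' : 'I_n) :
  i' = i.+1 :> nat -> j' = j.+1 :> nat -> gammap A i j = A i' j'.
Proof.
move=> ii' jj'; rewrite /gammap !mxE (bigD1 j') //= big1 => [|u uj].
  rewrite !mxE jj' eqxx mulr1 addr0 (bigD1 i') //= big1 => [|u ui].
    by rewrite !mxE ii' eqxx mul1r addr0.
  by rewrite !mxE -ii' (inj_eq val_inj) (negbTE ui) mul0r.
by rewrite !mxE -jj' (inj_eq val_inj) (negbTE uj) mulr0.
Qed.

Lemma gammap_last A (i j : 'I_n) :
  (i.+1 == n) || (j.+1 == n) -> gammap A i j = 0.
Proof.
move=> last; rewrite /gammap !mxE big1 // => u _; rewrite !mxE.
case: eqP => [uj|]; last by rewrite mulr0.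
rewrite mulr1 big1 // => v _; rewrite !mxE; case: eqP => [vi|]; last by rewrite mul0r.
by have := ltn_ord u; have := ltn_ord v; lia.
Qed.

Lemma gammamE A (i j i' j' : 'I_n) :
  i' = i.+1 :> nat -> j' = j.+1 :> nat -> gammam A i' j' = A i j.
Proof.
move=> ii' jj'; rewrite /gammam !mxE (bigD1 j) //= big1 => [|u uj].
  rewrite !mxE jj' eqxx mulr1 addr0 (bigD1 i) //= big1 => [|u ui].
    by rewrite !mxE ii' eqxx mul1r addr0.
  by rewrite !mxE ii' eqSS eq_sym (inj_eq val_inj) (negbTE ui) mul0r.
by rewrite !mxE jj' eqSS eq_sym (inj_eq val_inj) (negbTE uj) mulr0.
Qed.

Lemma gammam_first A (i j : 'I_n) :
  (i == 0 :> nat) || (j == 0 :> nat) -> gammam A i j = 0.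
Proof.
move=> first; rewrite /gammam !mxE big1 // => u _; rewrite !mxE.
case: eqP => [uj|]; last by rewrite mulr0.
rewrite mulr1 big1 // => v _; rewrite !mxE; case: eqP => [vi|]; last by rewrite mul0r.
lia.
Qed.

(** Whether [(i, j)] has a predecessor on its diagonal, from which [gammam] takes its value;
    [unshift_spec] does the same with successors for [gammap]. *)
Variant shift_spec (i j : 'I_n) : Prop :=
| ShiftFirst of (i == 0 :> nat) || (j == 0 :> nat)
| ShiftSucc (i1 j1 : 'I_n) of i = i1.+1 :> nat & j = j1.+1 :> nat.

Lemma shiftP (i j : 'I_n) : shift_spec i j.
Proof.
have [|] := boolP ((i == 0 :> nat) || (j == 0 :> nat)); first exact: ShiftFirst.
rewrite negb_or -!lt0n => /andP[i0 j0].
have lti : (i.-1 < n)%N by have := ltn_ord i; lia.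
have ltj : (j.-1 < n)%N by have := ltn_ord j; lia.
by apply: (@ShiftSucc i j (Ordinal lti) (Ordinal ltj)) => /=; lia.
Qed.

Variant unshift_spec (i j : 'I_n) : Prop :=
| ShiftLast of (i.+1 == n) || (j.+1 == n)
| ShiftPred (i1 j1 : 'I_n) of i1 = i.+1 :> nat & j1 = j.+1 :> nat.

Lemma unshiftP (i j : 'I_n) : unshift_spec i j.
Proof.
have [|] := boolP ((i.+1 == n) || (j.+1 == n)); first exact: ShiftLast.
rewrite negb_or => /andP[i0 j0].
have lti : (i.+1 < n)%N by have := ltn_ord i; lia.
have ltj : (j.+1 < n)%N by have := ltn_ord j; lia.
exact: (@ShiftPred i j (Ordinal lti) (Ordinal ltj)).
Qed.

Lemma gammap_upper A : gammap (upper_part A) = upper_part (gammap A).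
Proof.
apply/matrixP => i j; rewrite [RHS]mxE; have [last|i1 j1 ii jj] := unshiftP i j.
  by rewrite !gammap_last // if_same.
by rewrite !(gammapE _ ii jj) mxE ii jj ltnS.
Qed.

Lemma gammam_lower A : gammam (lower_part A) = lower_part (gammam A).
Proof.
apply/matrixP => i j; rewrite [RHS]mxE; have [first|i1 j1 ii jj] := shiftP i j.
  by rewrite !gammam_first // if_same.
by rewrite !(gammamE _ ii jj) mxE ii jj ltnS.
Qed.

Lemma upper_lowerD A : upper_part A + lower_part A = A.
Proof. by apply/matrixP => i j; rewrite !mxE; case: leqP; rewrite ?addr0 ?add0r. Qed.

Lemma upper_partD A B : upper_part (A + B) = upper_part A + upper_part B.
Proof. by apply/matrixP => i j; rewrite !mxE; case: ifP; rewrite ?addr0. Qed.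

Lemma upper_partB A B : upper_part (A - B) = upper_part A - upper_part B.
Proof. by apply/matrixP => i j; rewrite !mxE; case: ifP; rewrite ?subr0. Qed.

Lemma lower_partD A B : lower_part (A + B) = lower_part A + lower_part B.
Proof. by apply/matrixP => i j; rewrite !mxE; case: ifP; rewrite ?addr0. Qed.

Lemma lower_partB A B : lower_part (A - B) = lower_part A - lower_part B.
Proof. by apply/matrixP => i j; rewrite !mxE; case: ifP; rewrite ?subr0. Qed.

Lemma gammapD A B : gammap (A + B) = gammap A + gammap B.
Proof. by rewrite /gammap mulmxDr mulmxDl. Qed.

Lemma gammamD A B : gammam (A + B) = gammam A + gammam B.
Proof. by rewrite /gammam mulmxDr mulmxDl. Qed.

Lemma geomD (g : 'M[K]_n -> 'M[K]_n) A B :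
  {morph g : C D / C + D} -> geom g (A + B) = geom g A + geom g B.
Proof.
move=> gD; rewrite /geom -big_split; apply: eq_bigr => m _ /=.
by elim: (m : nat) => //= u ->; rewrite gD.
Qed.

Lemma trformC A B : trform A B = trform B A.
Proof. exact: mxtrace_mulC. Qed.

Lemma trformDl A B C : trform (A + B) C = trform A C + trform B C.
Proof. by rewrite /trform mulmxDl mxtraceD. Qed.

Lemma trformDr A B C : trform A (B + C) = trform A B + trform A C.
Proof. by rewrite /trform mulmxDr mxtraceD. Qed.

Lemma trformNl A B : trform (- A) B = - trform A B.
Proof. by rewrite /trform mulNmx raddfN. Qed.

Lemma trformBl A B C : trform (A - B) C = trform A C - trform B C.
Proof. by rewrite trformDl trformNl. Qed.

Lemma trformBr A B C : trform A (B - C) = trform A B - trform A C.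
Proof. by rewrite trformC trformBl !(trformC A). Qed.

Lemma trformZl c A B : trform (c *: A) B = c * trform A B.
Proof. by rewrite /trform -scalemxAl mxtraceZ. Qed.

Lemma trform_sum A B : trform A B = \sum_i \sum_j A i j * B j i.
Proof. by apply: eq_bigr => i _; rewrite mxE. Qed.

Lemma trform_gamma A B : trform (gammap A) B = trform A (gammam B).
Proof.
rewrite /trform /gammap /gammam -!mulmxA mxtrace_mulC.
by rewrite -!mulmxA.
Qed.

Lemma trform_geom A B : trform (geom (@gammap K n) A) B =
                        trform A (geom (@gammam K n) B).
Proof.
rewrite /trform /geom mulmx_suml mulmx_sumr !raddf_sum; apply: eq_bigr => m _ /=.
elim: (m : nat) A => // u IH A'; rewrite iterSr IH; exact: trform_gamma.
Qed.

(** * Triangular matrices and geometric series *)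

Definition strict_upper A := forall i j : 'I_n, (j <= i)%N -> A i j = 0.
Definition lower A := forall i j : 'I_n, (i < j)%N -> A i j = 0.
Definition upper A := forall i j : 'I_n, (j < i)%N -> A i j = 0.

Lemma trform_strict_upper A B : strict_upper A -> upper B -> trform A B = 0.
Proof.
move=> A0 B0; rewrite trform_sum big1 // => i _; rewrite big1 // => j _.
by case: (leqP j i) => ij; [rewrite A0 ?mul0r | rewrite B0 ?mulr0].
Qed.

Lemma trform_lower A B : lower A -> lower B -> trform A B = \sum_i A i i * B i i.
Proof.
move=> A0 B0; rewrite trform_sum; apply: eq_bigr => i _.
rewrite (bigD1 i) //= big1 ?addr0 // => j ji.
have [ij|ij|/val_inj ij] := ltngtP i j; last by rewrite ij eqxx in ji.
  by rewrite A0 ?mul0r.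
by rewrite B0 ?mulr0.
Qed.

Lemma trform_lower_upper A B :
  lower A -> (forall i j : 'I_n, (j < i)%N -> A i j = 0) ->
  trform A B = \sum_i A i i * B i i.
Proof.
move=> A0 A0'; rewrite trform_sum; apply: eq_bigr => i _.
rewrite (bigD1 i) //= big1 ?addr0 // => j ji.
have [ij|ij|/val_inj ij] := ltngtP i j; last by rewrite ij eqxx in ji.
  by rewrite A0 ?mul0r.
by rewrite A0' ?mul0r.
Qed.

Lemma lower_lower_part A : lower (lower_part A).
Proof. by move=> i j ij; rewrite mxE leqNgt ij. Qed.

Lemma strict_upper_upper_part A : strict_upper (upper_part A).
Proof. by move=> i j ij; rewrite mxE ltnNge ij. Qed.

Lemma geom_ind (P : 'M[K]_n -> Prop) (g : 'M[K]_n -> 'M[K]_n) A :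
  P 0 -> (forall B C, P B -> P C -> P (B + C)) -> (forall B, P B -> P (g B)) ->
  P A -> P (geom g A).
Proof.
move=> P0 PD Pg PA; apply: big_ind => // m _.
by elim: (m : nat) => //= u; apply: Pg.
Qed.

Lemma lower_geom A : lower A -> lower (geom (@gammam K n) A).
Proof.
apply: geom_ind => [i j _|B C B0 C0 i j ij|B B0 i j ij]; first by rewrite mxE.
  by rewrite mxE B0 ?C0 ?addr0.
have [first|i1 j1 ii jj] := shiftP i j; first by rewrite gammam_first.
by rewrite (gammamE _ ii jj) B0 //; rewrite ii jj ltnS in ij.
Qed.

Lemma upper_geom A : upper A -> upper (geom (@gammam K n) A).
Proof.
apply: geom_ind => [i j _|B C B0 C0 i j ij|B B0 i j ij]; first by rewrite mxE.
  by rewrite mxE B0 ?C0 ?addr0.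
have [first|i1 j1 ii jj] := shiftP i j; first by rewrite gammam_first.
by rewrite (gammamE _ ii jj) B0 //; rewrite ii jj ltnS in ij.
Qed.

Lemma strict_upper_geom A : strict_upper A -> strict_upper (geom (@gammap K n) A).
Proof.
apply: geom_ind => [i j _|B C B0 C0 i j ij|B B0 i j ij]; first by rewrite mxE.
  by rewrite mxE B0 ?C0 ?addr0.
have [last|i1 j1 ii jj] := unshiftP i j; first by rewrite gammap_last.
by rewrite (gammapE _ ii jj) B0 //; rewrite ii jj ltnS.
Qed.

(** [Rplus] without the terms involving traces. *)
Definition Rmain A := geom (@gammap K n) (upper_part A)
                      - gammam (geom (@gammam K n) (lower_part A)).

Lemma geom_gammapB A : geom (@gammap K n) (A - gammap A) = A.
Proof. by have [] := geom_gammapK A. Qed.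

Lemma geom_gammamB A : geom (@gammam K n) (A - gammam A) = A.
Proof. by have [] := geom_gammamK A. Qed.

Lemma gammam_geom A : gammam (geom (@gammam K n) A) = geom (@gammam K n) A - A.
Proof. by have [e _] := geom_gammamK A; rewrite -{3}e opprB addrC subrK. Qed.

(* Summation by parts: a + b = (1 - gammap) a + p = (1 - gammam) b + q, so the
   geometric series telescope on everything but p and q. *)
Lemma trform_Rmain (a b a' b' : 'M[K]_n) :
  let p := gammap a + b in let q := a + gammam b in
  let p' := gammap a' + b' in let q' := a' + gammam b' in
  trform (Rmain (a + b)) (a' + b') =
    trform a (a' + b') + trform (upper_part p) b'
    + trform (geom (@gammap K n) (upper_part p)) q'
    - trform (lower_part q) a' - trform (geom (@gammam K n) (lower_part q)) p'.
Proof.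
move=> p q p' q'.
have up : geom (@gammap K n) (upper_part (a + b)) =
    upper_part a + geom (@gammap K n) (upper_part p).
  have -> : upper_part (a + b) = (upper_part a - gammap (upper_part a)) + upper_part p.
    by rewrite gammap_upper -upper_partB -upper_partD addrA subrK.
  by rewrite (geomD _ _ gammapD) geom_gammapB.
have lo : gammam (geom (@gammam K n) (lower_part (a + b))) =
    geom (@gammam K n) (lower_part q) - lower_part a.
  have -> : lower_part (a + b) = (lower_part b - gammam (lower_part b)) + lower_part q.
    rewrite gammam_lower -lower_partB -lower_partD; congr lower_part.
    by rewrite addrACA addNr addr0 addrC.
  rewrite (geomD _ _ gammamD) geom_gammamB gammamD gammam_geom.
  rewrite {2}/q lower_partD -gammam_lower.
  by rewrite opprD addrCA [- _ - _]addrC addNKr.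
have -> : Rmain (a + b) = a + geom (@gammap K n) (upper_part p)
                          - geom (@gammam K n) (lower_part q).
  by rewrite /Rmain up lo opprB addrA (addrAC (upper_part a)) upper_lowerD.
rewrite trformBl trformDl.
(* Each of the two splittings of [a' + b'] is matched with the series whose adjoint telescopes on
   its second summand. *)
have e1 : a' + b' = q' + (b' - gammam b').
  by rewrite /q' addrACA subrr addr0.
have e2 : a' + b' = p' + (a' - gammap a').
  by rewrite [p' + _]addrC /p' addrA subrK.
have t1 : trform (geom (@gammap K n) (upper_part p)) (a' + b') =
    trform (geom (@gammap K n) (upper_part p)) q' + trform (upper_part p) b'.
  by rewrite e1 trformDr [X in _ + X]trform_geom geom_gammamB.
have t2 : trform (geom (@gammam K n) (lower_part q)) (a' + b') =
    trform (geom (@gammam K n) (lower_part q)) p' + trform (lower_part q) a'.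
  rewrite e2 trformDr [X in _ + X]trformC -trform_geom geom_gammapB.
  by rewrite [X in _ + X]trformC.
by rewrite t1 t2; ring.
Qed.

(** This computes the symmetric part of R_+, on which antisymmetry of the bracket rests. Pairings of
    strictly upper parts with geometric series cancel under the exchange of [A] and [B]. What is
    left involves diagonals only: the series of a lower part has the partial sums of the diagonal as
    its diagonal, and the sums over [j <= i] and over [i <= j] combine into the product of traces
    plus one extra diagonal. *)
Lemma Rmain_sym A B :
  trform (Rmain A) B + trform (Rmain B) A = trform A B - \tr A * \tr B.
Proof.
have step C D : trform (Rmain C) D =
    trform (upper_part C) (geom (@gammam K n) (lower_part D))
    - trform (geom (@gammam K n) (lower_part C)) D + trform (lower_part C) D.
  rewrite /Rmain trformBl trform_geom gammam_geom trformBl opprB addrA [RHS]addrAC.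
  congr (_ + _ - _).
  rewrite -{1}(upper_lowerD D) (geomD _ _ gammamD) trformDr trform_strict_upper ?add0r //.
    exact: strict_upper_upper_part.
  apply: upper_geom => i j ij; rewrite mxE ifF //; lia.
have diag C D : trform (geom (@gammam K n) (lower_part C)) D =
    trform (upper_part D) (geom (@gammam K n) (lower_part C)) +
    trform (geom (@gammam K n) (lower_part C)) (lower_part D).
  by rewrite -{1}(upper_lowerD D) trformDr [in X in X + _]trformC.
have geomii C (i0 : 'I_n) : geom (@gammam K n) (lower_part C) i0 i0 =
    \sum_(j : 'I_n | (j <= i0)%N) C j j.
  have rec (i : 'I_n) : geom (@gammam K n) (lower_part C) i i =
      C i i + gammam (geom (@gammam K n) (lower_part C)) i i.
    by rewrite gammam_geom; move: (geom _ _) => E; rewrite !mxE leqnn; ring.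
  have ind m (i : 'I_n) : i = m :> nat -> geom (@gammam K n) (lower_part C) i i =
      \sum_(j : 'I_n | (j <= i)%N) C j j.
    elim: m i => [|m IH] i im; rewrite rec (bigD1 i) //=; congr (_ + _).
      rewrite gammam_first ?im // big1 // => j /andP[ji j_i].
      by case/eqP: j_i; apply: val_inj => /=; lia.
    have [|i1 i2 ii1 ii2] := shiftP i i; first by rewrite im.
    have i12 : i1 = i2 by apply: val_inj => /=; lia.
    rewrite (gammamE _ ii1 ii2) -i12 IH; last by lia.
    apply: eq_bigl => j; rewrite -(inj_eq val_inj) /=; lia.
  exact: ind (erefl _).
have low C D : trform (geom (@gammam K n) (lower_part C)) (lower_part D) =
    \sum_(i < n) \sum_(j : 'I_n | (j <= i)%N) C j j * D i i.
  rewrite trform_lower; first last.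
  - exact: lower_lower_part.
  - exact/lower_geom/lower_lower_part.
  by apply: eq_bigr => i _; rewrite geomii mulr_suml [lower_part D i i]mxE leqnn.
have tot : trform (lower_part A) B + trform (lower_part B) A =
    trform A B + \sum_i A i i * B i i.
  have -> : trform (lower_part A) B =
      trform (lower_part A) (upper_part B) + trform (lower_part A) (lower_part B).
    by rewrite -trformDr upper_lowerD.
  have -> : trform (lower_part B) A =
      trform (upper_part A) (lower_part B) + trform (lower_part A) (lower_part B).
    by rewrite -trformDl upper_lowerD trformC.
  have -> : trform A B = trform (upper_part A) (lower_part B)
      + (trform (lower_part A) (upper_part B) + trform (lower_part A) (lower_part B)).
    rewrite -trformDr upper_lowerD -[trform (upper_part A) _]add0r.
    rewrite -(@trform_strict_upper (upper_part A) (upper_part B)); first last.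
    - by move=> i j ij; rewrite mxE ifF //; lia.
    - exact: strict_upper_upper_part.
    by rewrite -trformDr upper_lowerD -trformDl upper_lowerD.
  have -> : \sum_i A i i * B i i = trform (lower_part A) (lower_part B).
    rewrite trform_lower; try exact: lower_lower_part.
    by apply: eq_bigr => i _; rewrite !mxE leqnn.
  by ring.
have sumE : \sum_(i < n) \sum_(j : 'I_n | (j <= i)%N) A j j * B i i
    + \sum_(i < n) \sum_(j : 'I_n | (j <= i)%N) B j j * A i i
    = \tr A * \tr B + \sum_i A i i * B i i.
  rewrite [X in _ + X](exchange_big_dep xpredT) //= -big_split /=.
  rewrite /mxtrace mulr_sumr -big_split /=; apply: eq_bigr => i _.
  rewrite mulr_suml [in RHS](bigID (fun j : 'I_n => (j <= i)%N)) /= -addrA; congr (_ + _).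
  rewrite (bigD1 i) //= [RHS]addrC mulrC; congr (_ + _).
  apply: eq_big => [j|j _]; last by rewrite mulrC.
  by rewrite -(inj_eq val_inj) /=; lia.
rewrite !step (diag A B) (diag B A) !low.
rewrite -[trform A B](addrK (\sum_i A i i * B i i)) -tot.
by rewrite -[\tr A * _](addrK (\sum_i A i i * B i i)) -sumE; ring.
Qed.

Lemma trform_Rplus A B : trform (Rplus A) B = trform (Rmain A) B
  + (n%:R - 1) / (2 * n%:R) * \tr A * \tr B
  + n%:R^-1 * (\tr A * trform (@D_mx K n) B - trform (@D_mx K n) A * \tr B).
Proof.
have tr1 C : trform 1%:M C = \tr C by rewrite /trform mul1mx.
rewrite /Rplus -/(Rmain A) !trformDl !trformZl tr1; congr (_ + _ + _ * _).
by rewrite trformBl !trformZl tr1.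
Qed.

Definition diag_part A : 'M[K]_n := \matrix_(i, j) if i == j then A i j else 0.

(** The last row of [A], where triangularity is not assumed, only meets the last column of [B]. *)
Lemma trform_last_row A B :
  (forall i j : 'I_n, (j < i)%N -> (i.+1 < n)%N -> A i j = 0) ->
  (forall i j : 'I_n, j.+1 = n -> B i j = 0) ->
  trform A B = trform (upper_part A) B + trform (diag_part A) B.
Proof.
move=> A0 B0; rewrite -trformDl !trform_sum.
apply: eq_bigr => i _; apply: eq_bigr => j _; rewrite !mxE -(inj_eq val_inj) /=.
have [ij|ji|/val_inj ->] := ltngtP i j; rewrite ?addr0 ?add0r //.
have [lt_in|ge_in] := ltnP i.+1 n; first by rewrite A0 ?mul0r.
by rewrite B0 ?mulr0 ?mul0r //; have := ltn_ord i; lia.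
Qed.

(** * Reduction of the bracket to the cross term *)

Section Gradients.
Implicit Types (f g : dfun K n) (t : 'M[K]_n * 'M[K]_n).

Definition uncurried f t := f t.1 t.2.
(** These four matrices are a, b, c, d in this order; the prefix tells on which side [X] or [Y]
    multiplies, so that [E_R] is [lgradX + lgradY] and [E_L] is [rgradX + rgradY]. *)
Definition lgradX f t := t.1 *m gradX f t.1 t.2.
Definition lgradY f t := t.2 *m gradY f t.1 t.2.
Definition rgradX f t := gradX f t.1 t.2 *m t.1.
Definition rgradY f t := gradY f t.1 t.2 *m t.2.

Lemma trform_lrgradX f g t :
  trform (rgradX f t) (rgradX g t) = trform (lgradX f t) (lgradX g t).
Proof. by rewrite /trform /rgradX mulmxA mxtrace_mulC /lgradX !mulmxA. Qed.

Lemma trform_lrgradY f g t :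
  trform (rgradY f t) (rgradY g t) = trform (lgradY f t) (lgradY g t).
Proof. by rewrite /trform /rgradY mulmxA mxtrace_mulC /lgradY !mulmxA. Qed.

Lemma trace_lrgradX f t : \tr (rgradX f t) = \tr (lgradX f t).
Proof. exact: mxtrace_mulC. Qed.

Lemma trace_lrgradY f t : \tr (rgradY f t) = \tr (lgradY f t).
Proof. exact: mxtrace_mulC. Qed.

(** [E_L] and [E_R] have equal traces, so the terms with coefficient [(n - 1) / (2n)] cancel. *)
Lemma bracketDE f g t : bracketD f g t.1 t.2 =
  trform (Rmain (rgradX f t + rgradY f t)) (rgradX g t + rgradY g t)
  - trform (Rmain (lgradX f t + lgradY f t)) (lgradX g t + lgradY g t)
  + trform (lgradX f t) (lgradY g t) - trform (rgradX f t) (rgradY g t)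
  + n%:R^-1 *
    ((\tr (lgradX f t) + \tr (lgradY f t)) *
       (trform (@D_mx K n) (rgradX g t + rgradY g t)
        - trform (@D_mx K n) (lgradX g t + lgradY g t))
     - (trform (@D_mx K n) (rgradX f t + rgradY f t)
        - trform (@D_mx K n) (lgradX f t + lgradY f t)) *
       (\tr (lgradX g t) + \tr (lgradY g t))).
Proof.
have -> : bracketD f g t.1 t.2 =
    trform (Rplus (rgradX f t + rgradY f t)) (rgradX g t + rgradY g t)
    - trform (Rplus (lgradX f t + lgradY f t)) (lgradX g t + lgradY g t)
    + trform (lgradX f t) (lgradY g t) - trform (rgradX f t) (rgradY g t) by [].
move: (trace_lrgradX f t) (trace_lrgradX g t) (trace_lrgradY f t) (trace_lrgradY g t).
move: (lgradX f t) (lgradX g t) (lgradY f t) (lgradY g t) => a a' b b'.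
move: (rgradX f t) (rgradX g t) (rgradY f t) (rgradY g t) => c c' d d' ca ca' db db'.
by rewrite !trform_Rplus !mxtraceD ca ca' db db'; ring.
Qed.

(** By [Rmain_sym] the symmetric parts for [E_L] and [E_R] differ only in mixed terms, because
    [<c, c'> = <a, a'>] and [<d, d'> = <b, b'>]; these cancel against the last two terms of the
    bracket. *)
Lemma bracketD_antisym f g X Y : bracketD g f X Y = - bracketD f g X Y.
Proof.
pose t := (X, Y); apply/eqP; rewrite -addr_eq0.
rewrite (bracketDE g f t) (bracketDE f g t).
move: (trace_lrgradX f t) (trace_lrgradX g t) (trace_lrgradY f t) (trace_lrgradY g t).
move: (trform_lrgradX f g t) (trform_lrgradY f g t).
move: (lgradX f t) (lgradX g t) (lgradY f t) (lgradY g t) => a a' b b'.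
move: (rgradX f t) (rgradX g t) (rgradY f t) (rgradY g t) => c c' d d'.
move=> cc dd ca ca' db db'.
have := Rmain_sym (c + d) (c' + d'); have := Rmain_sym (a + b) (a' + b').
move: (trform (Rmain _) _) (trform (Rmain _) _) (trform (Rmain _) _) (trform (Rmain _) _).
move=> u1 u2 u3 u4.
rewrite !trformDl !trformDr !mxtraceD ca ca' db db' cc dd => u12 u34.
rewrite (trformC a' b) (trformC c' d).
apply/eqP; transitivity ((u2 + u1) - (u4 + u3)
  + (trform b a' + trform a b' - trform d c' - trform c d')); first by ring.
by rewrite u12 u34; ring.
Qed.

(* Infinitesimal semi-invariance of f under the left and right triangular actions
   on U. *)
Record compatible f : Prop := Compatible {
  compat_lX0 : forall t (i j : 'I_n), j = 0%N :> nat -> lgradX f t i j = 0;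
  compat_lYn : forall t (i j : 'I_n), j.+1 = n -> lgradY f t i j = 0;
  compat_left : forall t (i j : 'I_n), (j < i)%N -> (i.+1 < n)%N ->
    (gammap (lgradX f t) + lgradY f t) i j = 0;
  compat_left_diag : forall i : 'I_n, propto (uncurried f)
    (fun t => (gammap (lgradX f t) + lgradY f t) i i);
  compat_right : forall t, lower (gammap (rgradX f t) + rgradY f t);
  compat_right_diag : forall i : 'I_n, propto (uncurried f)
    (fun t => (gammap (rgradX f t) + rgradY f t) i i);
  compat_rX00 : forall i : 'I_n, i = 0%N :> nat ->
    propto (uncurried f) (fun t => rgradX f t i i) }.

(** Minus the expression that survives summation by parts. *)
Definition crossterm f g t :=
  trform (lower_part (rgradX f t + gammam (rgradY f t))) (rgradX g t)
  + trform (gammap (lgradX f t) + lgradY f t) (lgradY g t).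

Lemma propto_gammam (F : 'M[K]_n * 'M[K]_n -> K) (A_ : _ -> 'M[K]_n) :
  (forall i : 'I_n, propto F (fun t => A_ t i i)) ->
  forall i : 'I_n, propto F (fun t => gammam (A_ t) i i).
Proof.
move=> FA i; have [first|i1 i2 ii1 ii2] := shiftP i i.
  by apply: eq_propto (propto0 F) => t; rewrite gammam_first.
have i12 : i1 = i2 by apply: val_inj => /=; lia.
by apply: eq_propto (FA i1) => t; rewrite (gammamE _ ii1 ii2) i12.
Qed.

Lemma propto_geom (F : 'M[K]_n * 'M[K]_n -> K) (A_ : _ -> 'M[K]_n) :
  (forall i : 'I_n, propto F (fun t => A_ t i i)) ->
  forall i : 'I_n, propto F (fun t => geom (@gammam K n) (A_ t) i i).
Proof.
move=> FA i; have iter_pr m j : propto F (fun t => iter m (@gammam K n) (A_ t) j j).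
  by elim: m j => // m IH j; apply: propto_gammam.
have := propto_sum (index_enum 'I_n) (P := xpredT) (fun m _ => iter_pr (m : 'I_n) i).
by apply: eq_propto => t; rewrite summxE.
Qed.

(** By adjointness, since [1 - gammam 1] is the matrix unit at [(0, 0)]. *)
Lemma trace_gammap A (i0 : 'I_n) : i0 = 0%N :> nat ->
  \tr (gammap A) = \tr A - A i0 i0.
Proof.
move=> i00; have e : 1%:M - gammam 1%:M = delta_mx i0 i0 :> 'M[K]_n.
  apply/matrixP => i j; have [first|i1 j1 ii jj] := shiftP i j.
    rewrite mxE [X in _ + X]mxE gammam_first // subr0 !mxE -!(inj_eq val_inj) /= i00.
    by congr (_ %:R); lia.
  rewrite mxE [X in _ + X]mxE (gammamE _ ii jj) !mxE -!(inj_eq val_inj) /= i00 ii jj.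
  by rewrite eqSS subrr.
have -> : \tr (gammap A) = trform A (gammam 1%:M).
  by rewrite -trform_gamma /trform mulmx1.
apply/eqP; rewrite eq_sym subr_eq addrC -subr_eq.
rewrite -{1}[A]mulmx1 -/(trform A _) -trformBr e trform_sum.
rewrite (bigD1 i0) //= [X in _ + X]big1 => [|i ii0].
  rewrite addr0 (bigD1 i0) //= big1 => [|j ji0]; first by rewrite mxE !eqxx mulr1 addr0.
  by rewrite mxE (negbTE ji0) mulr0.
by rewrite big1 // => j _; rewrite mxE (negbTE ii0) andbF mulr0.
Qed.

(** On D_n, with diagonal 1, ..., n, [gammam] acts as subtraction of the identity, the first entry
    included. *)
Lemma trform_D_gammap A : trform (@D_mx K n) (gammap A) = trform (@D_mx K n) A - \tr A.
Proof.
have e : gammam (@D_mx K n) = @D_mx K n - 1%:M.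
  apply/matrixP => i j; have [first|i1 j1 ii jj] := shiftP i j.
    rewrite gammam_first // !mxE -!(inj_eq val_inj) /=.
    have [ij|] := eqVneq (i : nat) j; last by rewrite !mulr0n subrr.
    by move: first; rewrite ij orbb => /eqP ->; rewrite !mulr1n subrr.
  rewrite (gammamE _ ii jj) !mxE -!(inj_eq val_inj) /= ii jj eqSS.
  by case: eqP => _; rewrite ?subrr // -[i1.+2]addn1 natrD !mulr1n addrK.
by rewrite trformC trform_gamma e trformBr trformC; congr (_ - _); rewrite /trform mulmx1.
Qed.

Lemma compat_lower_diag h (i : 'I_n) : compatible h ->
  propto (uncurried h) (fun t => (rgradX h t + gammam (rgradY h t)) i i).
Proof.
move=> ch; have [first|i1 i2 ii1 ii2] := shiftP i i.
  have i0 : i = 0%N :> nat by lia.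
  apply: eq_propto (compat_rX00 ch i0) => t.
  by rewrite [RHS]mxE gammam_first ?i0 // addr0.
have i12 : i1 = i2 by apply: val_inj => /=; lia.
apply: eq_propto (compat_right_diag ch i1) => t.
by rewrite [LHS]mxE [RHS]mxE (gammamE _ ii1 ii2) -i12 -(gammapE _ ii1 ii1).
Qed.

Section Reduction.
Variables f g : dfun K n.
Hypotheses (cf : compatible f) (cg : compatible g).
Let fg t := uncurried f t * uncurried g t.

(** The shift pushes the exceptional last row of [gammap a + b] out of the matrix, and the first
    column that remains is that of [a], which is zero. *)
Lemma compat_gammam h t : compatible h ->
  upper (lgradX h t + gammam (lgradY h t)).
Proof.
move=> ch i j ij; rewrite mxE; have [first|i1 j1 ii jj] := shiftP i j.
  by rewrite gammam_first // (compat_lX0 ch) ?addr0 //; lia.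
rewrite (gammamE _ ii jj) -(gammapE _ ii jj).
have := compat_left ch t (i := i1) (j := j1); rewrite mxE; apply; first lia.
by have := ltn_ord i; lia.
Qed.

Lemma compat_lower_left h t : compatible h ->
  lower_part (lgradX h t + gammam (lgradY h t)) =
  gammam (diag_part (gammap (lgradX h t) + lgradY h t)).
Proof.
move=> ch; apply/matrixP => i j.
have -> : lower_part (lgradX h t + gammam (lgradY h t)) i j =
    if i == j then (lgradX h t + gammam (lgradY h t)) i j else 0.
  rewrite [LHS]mxE; case: (ltngtP i j) => [ij|ij|/val_inj ->].
  - by rewrite -(inj_eq val_inj) /= ltn_eqF.
  - by rewrite -(inj_eq val_inj) /= gtn_eqF // compat_gammam.
  - by rewrite eqxx.
have [first|i1 j1 ii jj] := shiftP i j.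
  rewrite (gammam_first _ first); case: eqP => // ij.
  rewrite mxE gammam_first // (compat_lX0 ch) ?addr0 //.
  by move: first; rewrite ij orbb => /eqP.
rewrite (gammamE _ ii jj) [RHS]mxE -!(inj_eq val_inj) /= ii jj eqSS.
by case: ifP => // _; rewrite [LHS]mxE [RHS]mxE (gammamE _ ii jj) (gammapE _ ii jj).
Qed.

Lemma propto_trform_diag (A B : 'M[K]_n * 'M[K]_n -> 'M[K]_n) :
  (forall t, lower (A t)) -> (forall t, lower (B t) \/ upper (A t)) ->
  (forall i : 'I_n, propto (uncurried f) (fun t => A t i i)) ->
  (forall i : 'I_n, propto (uncurried g) (fun t => B t i i)) ->
  propto fg (fun t => trform (A t) (B t)).
Proof.
move=> lA lBuA pA pB.
have := propto_sum (index_enum 'I_n) (P := xpredT)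
                   (fun i _ => proptoM (pA i) (pB i)).
apply: eq_propto => t; have [lB|uA] := lBuA t; first by rewrite trform_lower.
by rewrite trform_lower_upper.
Qed.

Lemma propto_trace_grad h : compatible h -> propto (uncurried h)
  (fun t => \tr (lgradX h t) + \tr (lgradY h t)).
Proof.
move=> ch; case: (posnP n) => [n0|n_gt0].
  apply: eq_propto (propto0 _) => t; rewrite /mxtrace !big1 ?addr0 // => i _;
    by exfalso; have := ltn_ord i; lia.
have c00 := compat_rX00 ch (i := Ordinal n_gt0) erefl.
have := propto_sum (index_enum 'I_n) (P := xpredT) (fun i _ => compat_right_diag ch i).
move/proptoD => /(_ _ c00); apply: eq_propto => t.
rewrite -/(\tr _) mxtraceD (@trace_gammap _ (Ordinal n_gt0)) //.
move: (trace_lrgradX h t) (trace_lrgradY h t).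
move: (lgradX h t) (lgradY h t) (rgradX h t) (rgradY h t) => a b c d ca db.
by rewrite -ca -db; ring.
Qed.

Lemma propto_D_grad h : compatible h -> propto (uncurried h)
  (fun t => trform (@D_mx K n) (rgradX h t + rgradY h t)
            - trform (@D_mx K n) (lgradX h t + lgradY h t)).
Proof.
move=> ch.
have trD A : trform (@D_mx K n) A = \sum_(i < n) i.+1%:R * A i i.
  rewrite /trform; apply: eq_bigr => i _; rewrite mul_diag_mx mxE.
  by rewrite mxE.
have prL : propto (uncurried h) (fun t =>
    trform (@D_mx K n) (gammap (lgradX h t) + lgradY h t)).
  have := propto_sum (index_enum 'I_n) (P := xpredT)
                     (fun (i : 'I_n) _ => proptoZ i.+1%:R (compat_left_diag ch i)).
  by apply: eq_propto => t; rewrite trD.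
have prR : propto (uncurried h) (fun t =>
    trform (@D_mx K n) (gammap (rgradX h t) + rgradY h t)).
  have := propto_sum (index_enum 'I_n) (P := xpredT)
                     (fun (i : 'I_n) _ => proptoZ i.+1%:R (compat_right_diag ch i)).
  by apply: eq_propto => t; rewrite trD.
apply: eq_propto (proptoB prR prL) => t.
move: (trace_lrgradX h t).
move: (lgradX h t) (lgradY h t) (rgradX h t) (rgradY h t) => a b c d ca.
by rewrite !trformDr !trform_D_gammap ca; ring.
Qed.

(** Apart from the cross term, each surviving term is a pairing of triangular matrices, which sees
    only diagonals, or a product of a trace of one gradient with a D_n pairing of the other. *)
Lemma propto_bracket :
  propto fg (crossterm f g) -> propto fg (fun t => bracketD f g t.1 t.2).
Proof.
move=> cross.
pose dp t := diag_part (gammap (lgradX f t) + lgradY f t).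
pose p' t := gammap (lgradX g t) + lgradY g t.
pose Q t := lower_part (rgradX f t + gammam (rgradY f t)).
pose P' t := gammap (rgradX g t) + rgradY g t.
have ldp t : lower (dp t).
  by move=> i j ij; rewrite mxE -(inj_eq val_inj) /= ltn_eqF.
have udp t : upper (dp t).
  by move=> i j ij; rewrite mxE -(inj_eq val_inj) /= gtn_eqF.
have pdp (i : 'I_n) : propto (uncurried f) (fun t => dp t i i).
  by apply: eq_propto (compat_left_diag cf i) => t; rewrite [RHS]mxE eqxx.
have pQ (i : 'I_n) : propto (uncurried f) (fun t => Q t i i).
  by apply: eq_propto (compat_lower_diag i cf) => t; rewrite [RHS]mxE leqnn.
have h1 : propto fg (fun t => trform (dp t) (p' t)).
  apply: propto_trform_diag => //; first by right.
  exact: compat_left_diag.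
have h2 : propto fg (fun t => trform (geom (@gammam K n) (Q t)) (P' t)).
  apply: propto_trform_diag => [t|t|i|i].
  - exact/lower_geom/lower_lower_part.
  - by left; apply: compat_right.
  - exact: propto_geom.
  - exact: compat_right_diag.
have h3 : propto fg (fun t => trform (geom (@gammam K n) (gammam (dp t))) (p' t)).
  apply: propto_trform_diag => [t|t|i|i].
  - apply: lower_geom => i j ij; have [first|i1 j1 ii jj] := shiftP i j.
      by rewrite gammam_first.
    by rewrite (gammamE _ ii jj) ldp //; lia.
  - right; apply: upper_geom => i j ij; have [first|i1 j1 ii jj] := shiftP i j.
      by rewrite gammam_first.
    by rewrite (gammamE _ ii jj) udp //; lia.
  - by apply: propto_geom => {}i; apply: propto_gammam.
  - exact: compat_left_diag.
have h4 : propto fg (fun t =>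
    (\tr (lgradX f t) + \tr (lgradY f t)) *
       (trform (@D_mx K n) (rgradX g t + rgradY g t)
        - trform (@D_mx K n) (lgradX g t + lgradY g t))).
  exact: proptoM (propto_trace_grad cf) (propto_D_grad cg).
have h5 : propto fg (fun t =>
   (trform (@D_mx K n) (rgradX f t + rgradY f t)
        - trform (@D_mx K n) (lgradX f t + lgradY f t)) *
       (\tr (lgradX g t) + \tr (lgradY g t))).
  exact: proptoM (propto_D_grad cf) (propto_trace_grad cg).
apply: eq_propto (proptoD (proptoB (proptoD (proptoB h1 h2) h3) cross)
  (proptoZ n%:R^-1 (proptoB h4 h5))) => t.
rewrite bracketDE /crossterm -/(Q t); congr (_ + _).
have low_left := compat_lower_left t cf.
have upQ : upper_part (gammap (rgradX f t) + rgradY f t) = 0.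
  apply/matrixP => i j; rewrite [LHS]mxE [RHS]mxE; case: ifP => // ij.
  exact: compat_right.
(* The [gammap] series drops out of both applications of [trform_Rmain]: for [E_L] it is applied to
   0 by [upQ], for [E_R] it is strictly upper triangular and meets an upper triangular matrix. *)
have z := trform_strict_upper (strict_upper_geom (@strict_upper_upper_part
  (gammap (lgradX f t) + lgradY f t))) (compat_gammam t cg).
have pb : trform (gammap (lgradX f t) + lgradY f t) (lgradY g t) =
    trform (upper_part (gammap (lgradX f t) + lgradY f t)) (lgradY g t)
    + trform (dp t) (lgradY g t).
  apply: trform_last_row => [i j|i j]; first exact: compat_left.
  exact: compat_lYn.
move: (trform_lrgradX f g t) z low_left pb upQ; rewrite /p' /P' /Q /dp.
move: (lgradX f t) (lgradX g t) (lgradY f t) (lgradY g t).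
move=> a a' b b'.
move: (rgradX f t) (rgradX g t) (rgradY f t) (rgradY g t) => c c' d d' cc z low_q pb up0.
have tr0 A : trform 0 A = 0 by rewrite /trform mul0mx mxtrace0.
rewrite !trform_Rmain up0 low_q z pb [trform (geom _ 0) _]trform_geom !tr0.
move: (diag_part _) => dq.
rewrite (trformC (gammam dq) a') -trform_gamma (trformC _ dq) (trformDr dq).
by rewrite !(trformDr c) !(trformDr a) cc; ring.
Qed.

End Reduction.

End Gradients.

End CremmerGervais.

(** * Minors and their gradients *)

Section Selection.
Variable K : numFieldType.

Lemma mulmx_sell m n l (S : 'M[K]_(m, n)) (Z : 'M[K]_(n, l)) i i' j :
  (forall u, S i u = (u == i')%:R) -> (S *m Z) i j = Z i' j.
Proof.
move=> Si; rewrite mxE (bigD1 i') //= big1 => [|u /negbTE ui].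
  by rewrite Si eqxx mul1r addr0.
by rewrite Si ui mul0r.
Qed.

Lemma mulmx_selr m n l (Z : 'M[K]_(m, n)) (S : 'M[K]_(n, l)) i j j' :
  (forall u, S u j = (u == j')%:R) -> (Z *m S) i j = Z i j'.
Proof.
move=> Sj; rewrite mxE (bigD1 j') //= big1 => [|u /negbTE uj].
  by rewrite Sj eqxx mulr1 addr0.
by rewrite Sj uj mulr0.
Qed.

Lemma mulmx_row0 m n l (S : 'M[K]_(m, n)) (Z : 'M[K]_(n, l)) i j :
  (forall u, S i u = 0) -> (S *m Z) i j = 0.
Proof. by move=> Si; rewrite mxE big1 // => u _; rewrite Si mul0r. Qed.

Lemma mulmx_col0 m n l (Z : 'M[K]_(m, n)) (S : 'M[K]_(n, l)) i j :
  (forall u, S u j = 0) -> (Z *m S) i j = 0.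
Proof. by move=> Sj; rewrite mxE big1 // => u _; rewrite Sj mulr0. Qed.

End Selection.

(** * Windows of the infinite matrix [U] and their adjugates *)

Section Window.
Variables (K : numFieldType) (p q k r s m : nat).
Implicit Types (x y : 'M[K]_(p, q)).

(** These 0-1 matrices read block [b] in the coordinates of the window with corner [(r, s)], so that
    submatrices of [U], and adjugates put back at the transposed position, become matrix
    products. *)
Definition wrows b : 'M[K]_(m, p) :=
  \matrix_(i, j) ((r + i)%N == (b * p + j)%N)%:R.
Definition wcols b : 'M[K]_(q, m) :=
  \matrix_(i, j) ((b * q + i)%N == (s + j)%N)%:R.

Definition brow x y a := y *m wcols a + x *m wcols a.+1.
Definition window x y := \sum_(b < k) wrows b *m brow x y b.
Definition adjblock x y a b := wcols a *m \adj (window x y) *m wrows b.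

Lemma wcols_inC a (i : 'I_q) (t : 'I_m) : (a * q + i = s + t)%N ->
  forall u, wcols a u t = (u == i)%:R.
Proof. by move=> ait u; rewrite mxE -ait eqn_add2l. Qed.

Lemma wcols_other a b (i : 'I_q) (t : 'I_m) : (a * q + i = s + t)%N -> b != a ->
  forall u, wcols b u t = 0.
Proof. by move=> ait ba u; rewrite mxE -ait block_eq (negbTE ba). Qed.

Lemma wrows_inC b (j : 'I_p) (t : 'I_m) : (r + t = b * p + j)%N ->
  forall u, wrows b t u = (u == j)%:R.
Proof. by move=> tbj u; rewrite mxE tbj eqn_add2l eq_sym. Qed.

Lemma wrows_other a b (j : 'I_p) (t : 'I_m) : (r + t = b * p + j)%N -> a != b ->
  forall u, wrows a t u = 0.
Proof. by move=> tbj ab u; rewrite mxE tbj block_eq eq_sym (negbTE ab). Qed.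

Lemma wcols_out a (i : 'I_q) : ~~ (s <= a * q + i < s + m)%N ->
  forall u, wcols a i u = 0.
Proof. by move=> out u; rewrite mxE; case: eqP => // e; have := ltn_ord u; lia. Qed.

Lemma wrows_out b (j : 'I_p) : ~~ (r <= b * p + j < r + m)%N ->
  forall u, wrows b u j = 0.
Proof. by move=> out u; rewrite mxE; case: eqP => // e; have := ltn_ord u; lia. Qed.

Hypothesis rmE : (r + m = k * p)%N.

Lemma window_row x y a (i : 'I_p) (t : 'I_m) l : (r + t = a * p + i)%N ->
  window x y t l = brow x y a i l.
Proof.
move=> tai; have ak : (a < k)%N.
  rewrite ltnNge; apply/negP => ka; have := leq_mul ka (leqnn p).
  by have := ltn_ord t; lia.
rewrite summxE (bigD1 (Ordinal ak)) //= big1 => [|b ba].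
  by rewrite addr0 (mulmx_sell _ _ (wrows_inC tai)).
by rewrite mulmx_row0 // => u; rewrite (wrows_other tai).
Qed.

Lemma windowE x y a b (i : 'I_p) (j : 'I_q) (t l : 'I_m) :
  (r + t = a * p + i)%N -> (b * q + j = s + l)%N ->
  window x y t l = if b == a then y i j else if b == a.+1 then x i j else 0.
Proof.
move=> tai bjl; rewrite (window_row _ _ _ tai) /brow mxE.
have [ba|ba] := eqVneq b a; first subst b.
  rewrite (mulmx_selr _ _ (wcols_inC bjl)) mulmx_col0 ?addr0 // => u.
  by rewrite (wcols_other bjl) // gtn_eqF.
rewrite [X in X + _]mulmx_col0 ?add0r => [|u]; last first.
  by rewrite (wcols_other bjl) // eq_sym.
have [ba1|ba1] := eqVneq b a.+1.
  by subst b; rewrite (mulmx_selr _ _ (wcols_inC bjl)).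
by rewrite mulmx_col0 // => u; rewrite (wcols_other bjl) // eq_sym.
Qed.

(** The zeros of [adjblock] confine the inner sums to the window, where the product of a matrix with
    its adjugate is the determinant times the identity. *)
Lemma adj_blocks_window x y :
  adj_blocks x y r s m (\det (window x y)) (adjblock x y).
Proof.
split=> a b i j.
- by move=> out; rewrite /adjblock -mulmxA mulmx_row0 //; apply: wcols_out.
- by move=> out; rewrite /adjblock mulmx_col0 //; apply: wrows_out.
- case/andP=> ri ir; have lt_t : (a * p + i - r < m)%N by lia.
  pose t := Ordinal lt_t; have tai : (r + t = a * p + i)%N by rewrite /=; lia.
  have -> : rowprod x y (adjblock x y) a b = brow x y a *m \adj (window x y) *m wrows b.
    by rewrite /rowprod /adjblock /brow !mulmxDl !mulmxA.
  have rowE u : (brow x y a *m \adj (window x y)) i u =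
      \det (window x y) *+ (t == u).
    have -> : (brow x y a *m \adj (window x y)) i u =
        (window x y *m \adj (window x y)) t u.
      by rewrite !mxE; apply: eq_bigr => v _; rewrite (window_row _ _ _ tai).
    by rewrite mul_mx_adj mxE.
  rewrite mxE (bigD1 t) //= big1 => [|u ut].
    by rewrite rowE eqxx mxE -tai addr0 mulr_natr.
  by rewrite rowE eq_sym (negbTE ut) mul0r.
- case/andP=> sj js; have lt_t : (b.+1 * q + j - s < m)%N by lia.
  pose t := Ordinal lt_t; have bjt : (b.+1 * q + j = s + t)%N by rewrite /=; lia.
  pose Z := wrows b.+1 *m y + wrows b *m x.
  have -> : colprod x y (adjblock x y) a b = wcols a *m (\adj (window x y) *m Z).
    by rewrite /colprod /adjblock /Z !mulmxDr !mulmxA.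
  have Zj u : Z u j = window x y u t.
    rewrite /window summxE mxE.
    have bx c : (wrows c *m brow x y c) u t =
        (if c == b.+1 then (wrows c *m y) u j else 0) +
        (if c == b then (wrows c *m x) u j else 0).
      rewrite /brow mulmxDr mxE !mulmxA; congr (_ + _).
        have [->|cb] := eqVneq c b.+1; first by rewrite (mulmx_selr _ _ (wcols_inC bjt)).
        by rewrite mulmx_col0 // => v; rewrite (wcols_other bjt).
      have [->|cb] := eqVneq c b; first by rewrite (mulmx_selr _ _ (wcols_inC bjt)).
      by rewrite mulmx_col0 // => v; rewrite (wcols_other bjt).
    (* For [c >= k] the sum contains no such block, and [wrows c] is zero because the window ends at
       row [k * p]. *)
    have pick c (z : 'M[K]_(p, q)) :
        \sum_(b0 < k) (if b0 == c :> nat then (wrows b0 *m z) u j else 0) =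
        (wrows c *m z) u j.
      have [ck|kc] := ltnP c k.
        rewrite (bigD1 (Ordinal ck)) //= eqxx big1 ?addr0 // => v.
        by rewrite -(inj_eq val_inj) /= => /negbTE ->.
      rewrite big1 => [|v _]; last by case: eqP => // vc; have := ltn_ord v; lia.
      rewrite mulmx_row0 // => v; apply: wrows_out.
      by have := leq_mul kc (leqnn p); lia.
    by under eq_bigr do rewrite bx; rewrite big_split /= !pick.
  have colE u : (\adj (window x y) *m Z) u j = \det (window x y) *+ (u == t).
    have -> : (\adj (window x y) *m Z) u j = (\adj (window x y) *m window x y) u t.
      by rewrite !mxE; apply: eq_bigr => v _; rewrite Zj.
    by rewrite mul_adj_mx mxE.
  rewrite mxE (bigD1 t) //= big1 => [|u /negbTE ut].
    by rewrite colE eqxx mulr1n mxE bjt addr0 mulr_natl.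
  by rewrite colE ut mulr0.
Qed.

Lemma window_line x y x' y' (h : K) :
  window (h *: x' + x) (h *: y' + y) =
  window x y + h *: \sum_(b < k) wrows b *m brow x' y' b.
Proof.
rewrite /window scaler_sumr -big_split; apply: eq_bigr => b _ /=.
rewrite scalemxAr -mulmxDr; congr (_ *m _).
rewrite /brow !mulmxDl -!scalemxAl scalerDr addrACA; exact: addrC.
Qed.

(** By Jacobi's formula, the gradients of the window determinant in the blocks [x] and [y], each
    summed over the block's copies in [U]; see [trace_adj_line]. *)
Definition sgradX x y := \sum_(b < k) adjblock x y b.+1 b.
Definition sgradY x y := \sum_(b < k) adjblock x y b b.

Lemma trace_adj_line x y x' y' :
  \tr (\adj (window x y) *m \sum_(b < k) wrows b *m brow x' y' b) =
  \tr (sgradX x y *m x') + \tr (sgradY x y *m y').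
Proof.
rewrite mulmx_sumr /sgradX /sgradY !mulmx_suml !raddf_sum -big_split /=.
apply: eq_bigr => b _; rewrite /brow !mulmxDr mxtraceD addrC; congr (_ + _).
  by rewrite !mulmxA mxtrace_mulC !mulmxA.
by rewrite !mulmxA mxtrace_mulC !mulmxA.
Qed.

End Window.

(** * Jacobi's formula and directional derivatives of determinants *)

Section DerivDet.
Variable K : numFieldType.

Lemma deriv_big_prod (I : eqType) (s : seq I) (F : I -> {poly K}) : uniq s ->
  (\prod_(i <- s) F i)^`() = \sum_(i <- s) (F i)^`() * \prod_(j <- s | j != i) F j.
Proof.
elim: s => [_|a s IH /= /andP[as_ us]]; first by rewrite !big_nil -polyC1 derivC.
rewrite !big_cons eqxx /= derivM IH // mulr_sumr; congr (_ * _ + _).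
  rewrite -[RHS]big_filter; congr (\prod_(i <- _) _); apply/esym/all_filterP.
  by apply/allP => j js; apply: contraNneq as_ => <-.
apply: eq_big_seq => i si; rewrite big_cons.
by case: eqVneq => [ai|_]; [rewrite ai si in as_ | rewrite mulrCA].
Qed.

(** Differentiate one row at a time and expand each determinant along that row. *)
Lemma deriv_det m (M : 'M[{poly K}]_m) :
  (\det M)^`() = \tr (\adj M *m map_mx (@deriv K) M).
Proof.
pose N i : 'M[{poly K}]_m := \matrix_(k, l) if k == i then (M i l)^`() else M k l.
have -> : (\det M)^`() = \sum_i \det (N i).
  rewrite /determinant raddf_sum exchange_big; apply: eq_bigr => s _ /=.
  rewrite -mulr_sumr !mulr_sign.
  have deriv_prod_sum : (\prod_i M i (s i))^`() = \sum_i \prod_k N i k (s k).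
    rewrite deriv_big_prod ?index_enum_uniq //; apply: eq_bigr => i _.
    rewrite [RHS](bigD1 i) //= mxE eqxx; congr (_ * _).
    by apply: eq_bigr => k ki; rewrite mxE (negbTE ki).
  by case: (odd_perm s); rewrite ?derivN -deriv_prod_sum.
rewrite mxtrace_mulC; apply: eq_bigr => i _.
rewrite (expand_det_row _ i) mxE; apply: eq_bigr => j _.
rewrite !mxE eqxx; congr (_ * (_ * \det _)).
apply/matrixP => k l; rewrite !mxE ifF //.
by rewrite eq_sym (negbTE (neq_lift _ _)).
Qed.

Lemma continuous_poly (q : {poly K}) : continuous (horner q : K -> K).
Proof.
elim/poly_ind: q => [|q c IH] x.
  rewrite (_ : horner 0 = cst 0); first exact: cst_continuous.
  by apply/funext => y; rewrite horner0.
have -> : horner (q * 'X + c%:P) = fun y => q.[y] * y + c.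
  by apply/funext => y; rewrite !hornerE.
have -> : (fun y => q.[y] * y + c) = (horner q \* @id K) \+ cst c by [].
apply: continuousD; last exact: cst_continuous.
by apply: continuousM; [exact: IH | by move=> y; exact: cvg_id].
Qed.

(** Along a line the determinant is a polynomial in [h]. Its difference quotient is a polynomial [q]
    away from 0, so the limit is [q(0)] by continuity, which is the formal derivative at 0. *)
Lemma derive_det_line n m (f : 'M[K]_n -> K^o) (X E : 'M[K]_n) (A B : 'M[K]_m) :
  (forall h, f (h *: E + X) = \det (A + h *: B)) ->
  'D_E f X = \tr (\adj A *m B).
Proof.
move=> fE; pose M : 'M[{poly K}]_m := map_mx polyC A + 'X *: map_mx polyC B.
have ME h : map_mx (horner_eval h) M = A + h *: B.
  by apply/matrixP => i j; rewrite !mxE /horner_eval !hornerE.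
have detM h : (\det M).[h] = \det (A + h *: B).
  by rewrite -[LHS]/(horner_eval h _) -det_map_mx ME.
have fX : f X = (\det M).[0] by rewrite detM -fE scale0r add0r.
have [q qM] : exists q, \det M - (\det M).[0]%:P = q * 'X.
  have /factor_theorem[q ->] : root (\det M - (\det M).[0]%:P) 0.
    by rewrite rootE !hornerE subrr.
  by exists q; rewrite subr0.
have -> : \tr (\adj A *m B) = q.[0].
  have -> : q.[0] = (\det M)^`().[0].
    have -> : \det M = q * 'X + (\det M).[0]%:P by rewrite -qM subrK.
    by rewrite derivD derivM derivC derivX !hornerE.
  rewrite deriv_det -[RHS]/(horner_eval 0 _) -trace_map_mx map_mxM map_mx_adj ME.
  rewrite scale0r addr0; congr (\tr (_ *m _)); apply/matrixP => i j.
  by rewrite !mxE -[RHS]/(horner (deriv _) 0) derivD derivM !derivC derivX !hornerE.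
rewrite /derive; apply: cvg_lim => //.
have cq : q.[h] @[h --> 0^'] --> q.[0].
  by apply: cvg_within_filter; exact: continuous_poly.
apply: cvg_trans cq; apply: near_eq_cvg; near=> h.
have h0 : h != 0 by near: h; exact: nbhs_dnbhs_neq.
have := congr1 (horner^~ h) qM; rewrite !hornerE -fX (detM h) -fE => qh.
by rewrite -[RHS]/(h^-1 * (f (h *: E + X) - f X)) qh mulrC mulfK.
Unshelve. all: by end_near.
Qed.
End DerivDet.

Lemma mxatE (K : numFieldType) m n (A : 'M[K]_(m, n)) u v (i : 'I_m) (j : 'I_n) :
  u = i.+1 -> v = j.+1 -> mxat A u v = A i j.
Proof. by move=> -> ->; rewrite /mxat /= !valK. Qed.

Lemma sum_shift (V : zmodType) k (F : nat -> V) : F 0%N = 0 -> F k = 0 ->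
  \sum_(b < k) F b = \sum_(b < k) F b.+1.
Proof.
move=> F0 Fk; have : \sum_(b < k.+1) F b = \sum_(b < k.+1) F b by [].
by rewrite {1}big_ord_recr big_ord_recl /= F0 Fk addr0 add0r.
Qed.

(** * Gradients of window minors in [X] and [Y], with [n = p + 1] *)

Section WindowMinors.
Variables (K : numFieldType) (p : nat).
Implicit Types (X Y E : 'M[K]_p.+1).

(** Left factors delete the first or last row, right factors prepend or append a zero column. With
    [calX] and [calY] written as two-sided products, gradients follow by cyclicity of the trace. *)
Definition rowshift1 : 'M[K]_(p, p.+1) := \matrix_(i, j) (j == i.+1 :> nat)%:R.
Definition rowshift0 : 'M[K]_(p, p.+1) := \matrix_(i, j) (j == i :> nat)%:R.
Definition colshift1 : 'M[K]_(p.+1, p.+2) := \matrix_(i, j) (j == i.+1 :> nat)%:R.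
Definition colshift0 : 'M[K]_(p.+1, p.+2) := \matrix_(i, j) (j == i :> nat)%:R.

Lemma rowshift1_row (i : 'I_p) (i' : 'I_p.+1) : i' = i.+1 :> nat ->
  forall u, rowshift1 i u = (u == i')%:R.
Proof. by move=> e u; rewrite mxE -e. Qed.

Lemma rowshift0_row (i : 'I_p) (i' : 'I_p.+1) : i' = i :> nat ->
  forall u, rowshift0 i u = (u == i')%:R.
Proof. by move=> e u; rewrite mxE -e. Qed.

Lemma rowshift1_col (j : 'I_p) (j' : 'I_p.+1) : j' = j.+1 :> nat ->
  forall u, rowshift1 u j' = (u == j)%:R.
Proof. by move=> e u; rewrite mxE e eqSS eq_sym. Qed.

Lemma rowshift0_col (j : 'I_p) (j' : 'I_p.+1) : j' = j :> nat ->
  forall u, rowshift0 u j' = (u == j)%:R.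
Proof. by move=> e u; rewrite mxE e eq_sym. Qed.

Lemma rowshift1_col0 (j : 'I_p.+1) : j = 0%N :> nat -> forall u, rowshift1 u j = 0.
Proof. by move=> e u; rewrite mxE e. Qed.

Lemma rowshift0_coln (j : 'I_p.+1) : j = p :> nat -> forall u, rowshift0 u j = 0.
Proof. by move=> e u; rewrite mxE e gtn_eqF. Qed.

Lemma colshift1_row (i : 'I_p.+1) (i' : 'I_p.+2) : i' = i.+1 :> nat ->
  forall u, colshift1 i u = (u == i')%:R.
Proof. by move=> e u; rewrite mxE -e. Qed.

Lemma colshift0_row (i : 'I_p.+1) (i' : 'I_p.+2) : i' = i :> nat ->
  forall u, colshift0 i u = (u == i')%:R.
Proof. by move=> e u; rewrite mxE -e. Qed.

Lemma colshift1_col (j : 'I_p.+1) (j' : 'I_p.+2) : j' = j.+1 :> nat ->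
  forall u, colshift1 u j' = (u == j)%:R.
Proof. by move=> e u; rewrite mxE e eqSS eq_sym. Qed.

Lemma colshift0_col (j : 'I_p.+1) (j' : 'I_p.+2) : j' = j :> nat ->
  forall u, colshift0 u j' = (u == j)%:R.
Proof. by move=> e u; rewrite mxE e eq_sym. Qed.

Lemma colshift1_col0 (j : 'I_p.+2) : j = 0%N :> nat -> forall u, colshift1 u j = 0.
Proof. by move=> e u; rewrite mxE e. Qed.

Lemma colshift0_coln (j : 'I_p.+2) : j = p.+1 :> nat -> forall u, colshift0 u j = 0.
Proof. by move=> e u; rewrite mxE e gtn_eqF. Qed.

Lemma calXE X : calX X = rowshift1 *m X *m colshift0 :> 'M[K]_(p, p.+2).
Proof.
apply/matrixP => i j; rewrite mxE; case: ltnP => [jn|nj]; last first.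
  by rewrite mulmx_col0 //; apply: colshift0_coln; have := ltn_ord j; lia.
rewrite (mulmx_selr _ _ (@colshift0_col (Ordinal jn) j erefl)).
have i1 : (i.+1 < p.+1)%N by have := ltn_ord i; rewrite /=; lia.
rewrite (mulmx_sell _ _ (@rowshift1_row i (Ordinal i1) erefl)).
exact: mxatE.
Qed.

Lemma calYE Y : calY Y = rowshift0 *m Y *m colshift1 :> 'M[K]_(p, p.+2).
Proof.
apply/matrixP => i j; rewrite mxE; case: posnP => [j0|j0].
  by rewrite mulmx_col0 //; apply: colshift1_col0.
have jn : (j.-1 < p.+1)%N by have := ltn_ord j; lia.
have i1 : (i < p.+1)%N by have := ltn_ord i; rewrite /=; lia.
have e : j = (Ordinal jn).+1 :> nat by rewrite /= prednK.
rewrite (mulmx_selr _ _ (colshift1_col e)).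
rewrite (mulmx_sell _ _ (@rowshift0_row i (Ordinal i1) erefl)).
exact: mxatE.
Qed.

Lemma calY_col0 Y (i : 'I_p) (j : 'I_p.+2) : j = 0%N :> nat -> calY Y i j = 0.
Proof. by move=> j0; rewrite mxE j0. Qed.

Lemma calX_coln X (i : 'I_p) (j : 'I_p.+2) : j = p.+1 :> nat -> calX X i j = 0.
Proof. by move=> j0; rewrite mxE j0 ltnn. Qed.

Lemma trace_delta n (A : 'M[K]_n) i j : \tr (A *m delta_mx j i) = A i j.
Proof.
rewrite /mxtrace (bigD1 i) //= big1 => [|u ui]; last first.
  by apply: mulmx_col0 => v; rewrite mxE (negbTE ui) andbF.
by rewrite addr0; apply: mulmx_selr => v; rewrite mxE eqxx andbT.
Qed.

Section OneMinor.
Variables (k r s m : nat).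
Definition wminor : dfun K p.+1 := fun X Y =>
  \det (window k r s m (calX X : 'M_(p, p.+2)) (calY Y)).

Definition wgradX (t : 'M[K]_p.+1 * 'M[K]_p.+1) : 'M[K]_(p.+2, p) :=
  sgradX k r s m (calX t.1) (calY t.2).
Definition wgradY (t : 'M[K]_p.+1 * 'M[K]_p.+1) : 'M[K]_(p.+2, p) :=
  sgradY k r s m (calX t.1) (calY t.2).

Lemma gradX_wminor t : gradX wminor t.1 t.2 = colshift0 *m wgradX t *m rowshift1.
Proof.
apply/matrixP => i j; rewrite mxE; set E := delta_mx j i.
rewrite (derive_det_line (A := window k r s m (calX t.1 : 'M_(p, p.+2)) (calY t.2))
  (B := \sum_(b < k) wrows K p r m b *m brow s m (calX E : 'M_(p, p.+2)) 0 b)) => [|h].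
  rewrite trace_adj_line mulmx0 mxtrace0 addr0 (calXE E) -trace_delta -/E.
  by rewrite !mulmxA mxtrace_mulC !mulmxA.
rewrite -window_line scaler0 add0r /wminor; congr (\det (window _ _ _ _ _ _)).
by rewrite !calXE mulmxDr mulmxDl -scalemxAr -scalemxAl.
Qed.

Lemma gradY_wminor t : gradY wminor t.1 t.2 = colshift1 *m wgradY t *m rowshift0.
Proof.
apply/matrixP => i j; rewrite mxE; set E := delta_mx j i.
rewrite (derive_det_line (A := window k r s m (calX t.1 : 'M_(p, p.+2)) (calY t.2))
  (B := \sum_(b < k) wrows K p r m b *m brow s m (0 : 'M_(p, p.+2)) (calY E) b)) => [|h].
  rewrite trace_adj_line mulmx0 mxtrace0 add0r (calYE E) -trace_delta -/E.
  by rewrite !mulmxA mxtrace_mulC !mulmxA.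
rewrite -window_line scaler0 add0r /wminor; congr (\det (window _ _ _ _ _ _)).
by rewrite !calYE mulmxDr mulmxDl -scalemxAr -scalemxAl.
Qed.

Implicit Types t : 'M[K]_p.+1 * 'M[K]_p.+1.

(** The sums of the diagonal blocks of [U G] and of [G U], as [rsumE] and [csumE] show. *)
Definition rsum t : 'M[K]_p := calX t.1 *m wgradX t + calY t.2 *m wgradY t.
Definition csum t : 'M[K]_p.+2 := wgradX t *m calX t.1 + wgradY t *m calY t.2.

Lemma rgradX_wminor t (i j : 'I_p.+1) (i' j' : 'I_p.+2) :
  i' = i :> nat -> j' = j :> nat ->
  rgradX wminor t i j = (wgradX t *m calX t.1) i' j'.
Proof.
move=> ei ej; rewrite /rgradX gradX_wminor calXE -!mulmxA !(mulmxA colshift0).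
rewrite -mulmxA (mulmx_sell _ _ (colshift0_row ei)) !mulmxA.
by rewrite (mulmx_selr _ _ (colshift0_col ej)).
Qed.

Lemma rgradY_wminor t (i j : 'I_p.+1) (i' j' : 'I_p.+2) :
  i' = i.+1 :> nat -> j' = j.+1 :> nat ->
  rgradY wminor t i j = (wgradY t *m calY t.2) i' j'.
Proof.
move=> ei ej; rewrite /rgradY gradY_wminor calYE -!mulmxA !(mulmxA colshift1).
rewrite -mulmxA (mulmx_sell _ _ (colshift1_row ei)) !mulmxA.
by rewrite (mulmx_selr _ _ (colshift1_col ej)).
Qed.

Lemma lgradX_wminor t (i j : 'I_p.+1) (i' j' : 'I_p) :
  i = i'.+1 :> nat -> j = j'.+1 :> nat ->
  lgradX wminor t i j = (calX t.1 *m wgradX t) i' j'.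
Proof.
move=> ei ej; rewrite /lgradX gradX_wminor calXE !mulmxA.
rewrite (mulmx_selr _ _ (rowshift1_col ej)) -!mulmxA.
by rewrite (mulmx_sell _ _ (rowshift1_row ei)) !mulmxA.
Qed.

Lemma lgradY_wminor t (i j : 'I_p.+1) (i' j' : 'I_p) :
  i = i' :> nat -> j = j' :> nat ->
  lgradY wminor t i j = (calY t.2 *m wgradY t) i' j'.
Proof.
move=> ei ej; rewrite /lgradY gradY_wminor calYE !mulmxA.
rewrite (mulmx_selr _ _ (rowshift0_col ej)) -!mulmxA.
by rewrite (mulmx_sell _ _ (rowshift0_row ei)) !mulmxA.
Qed.

Lemma lgradX_wminor0 t (i j : 'I_p.+1) : j = 0%N :> nat -> lgradX wminor t i j = 0.
Proof.
move=> j0; rewrite /lgradX gradX_wminor !mulmxA mulmx_col0 //.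
exact: rowshift1_col0.
Qed.

Lemma lgradY_wminorn t (i j : 'I_p.+1) : j.+1 = p.+1 -> lgradY wminor t i j = 0.
Proof.
move=> [j0]; rewrite /lgradY gradY_wminor !mulmxA mulmx_col0 //.
exact: rowshift0_coln.
Qed.

Lemma left_wminor t (i j : 'I_p.+1) (i' j' : 'I_p) :
  i' = i :> nat -> j' = j :> nat ->
  (gammap (lgradX wminor t) + lgradY wminor t) i j = rsum t i' j'.
Proof.
move=> ei ej; rewrite mxE [RHS]mxE; congr (_ + _); last exact: lgradY_wminor.
have [last|i1 j1 ii jj] := unshiftP i j.
  by have := ltn_ord i'; have := ltn_ord j'; lia.
by rewrite (gammapE _ ii jj); apply: lgradX_wminor; lia.
Qed.

(** [gammap] aligns the columns of [X] in [calX] with those of [Y] in [calY], which sit one place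
    further right. On or above the diagonal, the entries lost by the shift face the zero last column
    of [calX]. *)
Lemma right_wminor t (i j : 'I_p.+1) (i' j' : 'I_p.+2) :
  (i <= j)%N -> i' = i.+1 :> nat -> j' = j.+1 :> nat ->
  (gammap (rgradX wminor t) + rgradY wminor t) i j = csum t i' j'.
Proof.
move=> ij ei ej; rewrite mxE [RHS]mxE; congr (_ + _); last exact: rgradY_wminor.
have [last|i1 j1 ii jj] := unshiftP i j.
  rewrite gammap_last // mulmx_col0 // => u; apply: calX_coln.
  by have := ltn_ord j; lia.
by rewrite (gammapE _ ii jj); apply: rgradX_wminor; lia.
Qed.

Lemma lower_wminor t (i j : 'I_p.+1) (i' j' : 'I_p.+2) :
  (j <= i)%N -> i' = i :> nat -> j' = j :> nat ->
  (rgradX wminor t + gammam (rgradY wminor t)) i j = csum t i' j'.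
Proof.
move=> ij ei ej; rewrite mxE [RHS]mxE; congr (_ + _); first exact: rgradX_wminor.
have [first|i1 j1 ii jj] := shiftP i j.
  by rewrite gammam_first // mulmx_col0 // => u; apply: calY_col0; lia.
by rewrite (gammamE _ ii jj); apply: rgradY_wminor; lia.
Qed.

Definition wblock t := adjblock k r s m (calX t.1 : 'M_(p, p.+2)) (calY t.2).

Hypothesis rmE : (r + m = k * p)%N.

Lemma adj_wblock t :
  adj_blocks (calX t.1) (calY t.2) r s m (uncurried wminor t) (wblock t).
Proof. exact: adj_blocks_window. Qed.

Hypotheses (k_gt0 : (0 < k)%N) (qs : (p.+2 <= s)%N).

Lemma rsumE t : rsum t = \sum_(b < k) rowprod (calX t.1) (calY t.2) (wblock t) b b.
Proof.
rewrite /rsum /wgradX /wgradY /sgradX /sgradY !mulmx_sumr -big_split /=.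
by apply: eq_bigr => b _; rewrite addrC.
Qed.

Lemma wblock00 t : wblock t 0 0 = 0.
Proof.
apply/matrixP => i j; rewrite (adj_col0 (adj_wblock t)) ?mxE // mul0n.
by have := ltn_ord i; lia.
Qed.

Lemma wblock_last t b : (k <= b)%N -> wblock t b b = 0.
Proof. by move=> kb; apply: (adj_row_eq0 (adj_wblock t) rmE). Qed.

(** The blocks of the [Y] gradient are reindexed by one to pair with those of [X]; nothing is lost
    since both end blocks, [G_{0,0}] and [G_{k,k}], vanish. *)
Lemma csumE t : csum t = \sum_(b < k) colprod (calX t.1) (calY t.2) (wblock t) b.+1 b.
Proof.
rewrite /csum /wgradX /wgradY /sgradX /sgradY.
have -> : \sum_(b < k) adjblock k r s m (calX t.1 : 'M_(p, p.+2)) (calY t.2) b b =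
          \sum_(b < k) wblock t b.+1 b.+1.
  by apply: (sum_shift (F := fun b => wblock t b b));
    [exact: wblock00 | exact: wblock_last].
rewrite !mulmx_suml -big_split /=.
by apply: eq_bigr => b _; rewrite addrC.
Qed.

Hypothesis smE : (k * p.+2 <= s + m)%N.
(** The first case is for [phi] and [psi]; in the second the window ends at the last column of [X]
    inside block column [k], as for [theta]. *)
Hypothesis sm_cases : (s + m <= (k * p.+2).+1)%N \/ (s + m = k * p.+2 + p.+1)%N.

(** Only columns past the window's end need care. In the first case of [sm_cases] row [i > 0] is
    then past the end as well; in the second, [j] is the zero last column of [calX]. *)
Lemma csum_upper t (i j : 'I_p.+2) : (0 < i)%N -> (i < j)%N -> csum t i j = 0.
Proof.
move=> i0 ij; rewrite csumE summxE big1 // => b _.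
have [lt_e|ge_e] := ltnP (b.+1 * p.+2 + j) (s + m).
  exact: (colprod_diag_upper (adj_wblock t)).
have kb : (k <= b.+1)%N.
  rewrite leqNgt; apply/negP => bk; have := leq_mul bk (leqnn p.+2).
  by rewrite mulSn; have := ltn_ord j; lia.
case: sm_cases => e.
  rewrite (colprod_row0 (adj_wblock t)) //.
  by have := leq_mul kb (leqnn p.+2); lia.
have bk : b.+1 = k by apply/eqP; rewrite eqn_leq kb ltn_ord.
rewrite /colprod wblock_last // mul0mx add0r mulmx_col0 // => u; apply: calX_coln.
by rewrite bk in ge_e; have := ltn_ord j; lia.
Qed.

Lemma csum_diag (i : 'I_p.+2) : propto (uncurried wminor) (fun t => csum t i i).
Proof.
have pr b : propto (uncurried wminor) (fun t =>
    colprod (calX t.1) (calY t.2) (wblock t) b.+1 b i i).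
  apply: eq_propto (proptoMn _ (propto_refl _)) => t.
  by rewrite (colprod_diag (adj_wblock t)).
have := propto_sum (index_enum 'I_k) (P := xpredT) (fun b _ => pr b).
by apply: eq_propto => t; rewrite csumE summxE.
Qed.

Lemma rsum_diag (i : 'I_p) : propto (uncurried wminor) (fun t => rsum t i i).
Proof.
have pr b : propto (uncurried wminor) (fun t =>
    rowprod (calX t.1) (calY t.2) (wblock t) b b i i).
  apply: eq_propto (proptoMn _ (propto_refl _)) => t.
  by rewrite (rowprod_diag (adj_wblock t)).
have := propto_sum (index_enum 'I_k) (P := xpredT) (fun b _ => pr b).
by apply: eq_propto => t; rewrite rsumE summxE.
Qed.

Lemma compatible_wminor : compatible wminor.
Proof.
split=> [t i j|t i j|t i j ji ip|i|t i j ij|i|i i0].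
- exact: lgradX_wminor0.
- exact: lgradY_wminorn.
- have jp : (j < p)%N by lia.
  have ip' : (i < p)%N by lia.
  rewrite (@left_wminor t i j (Ordinal ip') (Ordinal jp)) // rsumE summxE big1 // => b _.
  exact: (rowprod_diag_lower (adj_wblock t) rmE).
- have [ip|pi] := ltnP i p.
    apply: eq_propto (rsum_diag (Ordinal ip)) => t.
    by rewrite (@left_wminor t i i (Ordinal ip) (Ordinal ip)).
  apply: eq_propto (propto0 _) => t.
  by rewrite mxE gammap_last ?lgradY_wminorn ?addr0 //; have := ltn_ord i; lia.
- rewrite (right_wminor t (ltnW ij) (lift0 i) (lift0 j)).
  by apply: csum_upper; [ | exact: ij].
- apply: eq_propto (csum_diag (lift ord0 i)) => t.
  by rewrite (right_wminor t (leqnn i) (lift0 i) (lift0 i)).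
- apply: eq_propto (csum_diag ord0) => t.
  rewrite (@rgradX_wminor t i i ord0 ord0) // mxE.
  by rewrite [X in _ + X]mulmx_col0 ?addr0 // => u; apply: calY_col0.
Qed.

End OneMinor.

Implicit Types t : 'M[K]_p.+1 * 'M[K]_p.+1.

Section TwoMinors.
Variables (k r s m r' s' m' : nat).

Lemma crossterm_wminor t :
  crossterm (wminor k r s m) (wminor k r' s' m') t =
  \tr (lower_part (csum k r s m t) *m (wgradX k r' s' m' t *m calX t.1))
  + \tr (rsum k r s m t *m (calY t.2 *m wgradY k r' s' m' t)).
Proof.
rewrite /crossterm /trform; congr (_ + _).
  set Q := lower_part (_ + _).
  (* The last column of a lower part is supported in the last row, which [colshift0] drops. *)
  have QC : Q *m colshift0 = colshift0 *m lower_part (csum k r s m t).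
    apply/matrixP => i j; have wi : widen_ord (leqnSn _) i = i :> nat by [].
    rewrite [RHS](mulmx_sell _ _ (colshift0_row wi)) [RHS]mxE /=.
    have [jn|nj] := ltnP j p.+1; last first.
      rewrite mulmx_col0; last by apply: colshift0_coln; have := ltn_ord j; lia.
      by rewrite ifF //; have := ltn_ord i; lia.
    rewrite (mulmx_selr _ _ (@colshift0_col (Ordinal jn) j erefl)) mxE /=.
    by case: ifP => // ji; apply: lower_wminor.
  rewrite /rgradX gradX_wminor calXE mulmxA -[colshift0 *m _ *m _]mulmxA !mulmxA QC.
  by rewrite -!mulmxA mxtrace_mulC !mulmxA.
set P := gammap _ + _.
have PR : rowshift0 *m P = rsum k r s m t *m rowshift0.
  apply/matrixP => i j; have wi : widen_ord (leqnSn _) i = i :> nat by [].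
  rewrite (mulmx_sell _ _ (rowshift0_row wi)).
  have [jn|nj] := ltnP j p.
    rewrite (mulmx_selr _ _ (@rowshift0_col (Ordinal jn) j erefl)).
    exact: left_wminor.
  have jp : j = p :> nat by have := ltn_ord j; lia.
  rewrite [RHS]mulmx_col0; last exact: rowshift0_coln.
  by rewrite mxE gammap_last ?lgradY_wminorn ?addr0 ?jp //; lia.
by rewrite /lgradY gradY_wminor calYE !mulmxA mxtrace_mulC !mulmxA PR.
Qed.

Hypotheses (rmE : (r + m = k * p)%N) (rmE' : (r' + m' = k * p)%N).
Hypotheses (k_gt0 : (0 < k)%N) (qs : (p.+2 <= s)%N) (qs' : (p.+2 <= s')%N).
Hypotheses (smE : (k * p.+2 <= s + m <= (k * p.+2).+1)%N).
Hypotheses (smE' : (k * p.+2 <= s' + m' <= (k * p.+2).+1)%N).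
Hypotheses (rr' : (r <= r')%N) (ss' : (s <= s')%N).

(** Block rows from [k] on meet the window at most in column [k * p.+2], which is the zero first
    column of [calY]. *)
Lemma wblock_below r0 s0 m0 t a b (i j : 'I_p) :
  (s0 + m0 <= (k * p.+2).+1)%N -> (k <= a)%N ->
  rowprod (calX t.1) (calY t.2) (wblock k r0 s0 m0 t) a b i j = 0.
Proof.
move=> e ka; have out0 c (u : 'I_p.+2) : (k <= c)%N -> (0 < u)%N ->
    forall v, wcols K p.+2 s0 m0 c u v = 0.
  by move=> kc u0; apply: wcols_out; have := leq_mul kc (leqnn p.+2); lia.
have out1 (u : 'I_p.+2) : forall v, wcols K p.+2 s0 m0 a.+1 u v = 0.
  by apply: wcols_out; have := leq_mul ka (leqnn p.+2); rewrite mulSn; lia.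
have row0 : brow s0 m0 (calX t.1 : 'M_(p, p.+2)) (calY t.2) a = 0.
  apply/matrixP => u v; rewrite mxE [RHS]mxE [X in _ + X]mulmx_col0 ?addr0 => [|w].
    rewrite mxE big1 // => w _; have [w0|w0] := posnP w.
      by rewrite calY_col0 ?mul0r.
    by rewrite out0 ?mulr0.
  exact: out1.
have -> : rowprod (calX t.1) (calY t.2) (wblock k r0 s0 m0 t) a b =
    brow s0 m0 (calX t.1 : 'M_(p, p.+2)) (calY t.2) a
    *m \adj (window k r0 s0 m0 (calX t.1) (calY t.2)) *m wrows K p r0 m0 b.
  by rewrite /rowprod /wblock /adjblock /brow !mulmxDl !mulmxA.
by rewrite row0 !mul0mx mxE.
Qed.

Lemma lower_part_sum n (I : finType) (F : I -> 'M[K]_n) :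
  lower_part (\sum_i F i) = \sum_i lower_part (F i).
Proof.
apply: (big_morph _ (@lower_partD _ _)).
by apply/matrixP => i j; rewrite !mxE if_same.
Qed.

Lemma propto_crossterm_wminor :
  propto (fun t => uncurried (wminor k r s m) t * uncurried (wminor k r' s' m') t)
         (crossterm (wminor k r s m) (wminor k r' s' m')).
Proof.
have [smk smk1] := andP smE; have [smk' smk1'] := andP smE'.
have cross a l := @propto_cross K p p.+2 _ (fun t => calX t.1) (fun t => calY t.2)
  k r s m r' s' m' _ _ (wblock k r s m) (wblock k r' s' m')
  (fun t => @calY_col0 t.2) (adj_wblock s rmE) (adj_wblock s' rmE') rmE rmE' smE smE'
  (fun t a b i j => wblock_below r' t b i j smk1') isT qs qs' rr' ss' a l.
have := propto_sum (index_enum 'I_k) (P := xpredT) (fun a _ =>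
  propto_sum (index_enum 'I_k) (P := xpredT) (fun l _ => cross a l)).
apply: eq_propto => t; rewrite crossterm_wminor (csumE rmE k_gt0 qs) rsumE.
rewrite lower_part_sum /wgradX /wgradY /sgradX /sgradY mulmx_suml mulmx_sumr.
rewrite !mulmx_suml !raddf_sum -big_split /=; apply: eq_bigr => a _.
by rewrite !mulmx_sumr !raddf_sum -big_split.
Qed.

End TwoMinors.

(** * Trailing minors of [X] as windows inside block column [k] *)

Section CornerMinors.
Variables (k m : nat).
Hypotheses (k_gt0 : (0 < k)%N) (m_gt0 : (0 < m)%N) (mp : (m <= p)%N).
Let r := (k * p - m)%N.
Let s := (k * p.+2 + (p.+1 - m))%N.

Lemma corner_rm : (r + m = k * p)%N.
Proof. by have := leq_mul k_gt0 (leqnn p); rewrite /r; lia. Qed.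

Lemma corner_qs : (p.+2 <= s)%N.
Proof. by have := leq_mul k_gt0 (leqnn p.+2); rewrite /s; lia. Qed.

Lemma corner_sm : (s + m <= (k * p.+2).+1)%N \/ (s + m = k * p.+2 + p.+1)%N.
Proof. by right; rewrite /s; lia. Qed.

Lemma corner_kq : (k * p.+2 <= s + m)%N.
Proof. by rewrite /s; lia. Qed.

Lemma compatible_corner : compatible (wminor k r s m).
Proof. exact: compatible_wminor corner_rm k_gt0 corner_qs corner_kq corner_sm. Qed.

Lemma wgradY_corner t : wgradY k r s m t = 0.
Proof.
apply: big1 => b _; apply/matrixP => i j.
rewrite (adj_col0 (adj_wblock s corner_rm t)) ?mxE //.
have := leq_mul (ltn_ord b) (leqnn p.+2); rewrite mulSn /s.
by have := ltn_ord i; lia.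
Qed.

(** The gradient in [Y] is zero, so one pairing remains, between a lower part and the lower
    triangular [csum]. Nothing but compatibility is needed of [f]. *)
Lemma propto_crossterm_corner f : compatible f ->
  propto (fun t => uncurried f t * uncurried (wminor k r s m) t)
         (crossterm f (wminor k r s m)).
Proof.
move=> cf.
have rX t (i j : 'I_p.+1) (i' j' : 'I_p.+2) : i' = i :> nat -> j' = j :> nat ->
    rgradX (wminor k r s m) t i j = csum k r s m t i' j'.
  move=> ei ej; rewrite (@rgradX_wminor k r s m t i j i' j') // /csum.
  by rewrite wgradY_corner mul0mx addr0.
have diag : propto (fun t => uncurried f t * uncurried (wminor k r s m) t) (fun t =>
    trform (lower_part (rgradX f t + gammam (rgradY f t))) (rgradX (wminor k r s m) t)).
  apply: propto_trform_diag => [t|t|i|i].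
  - exact: lower_lower_part.
  - left=> i j ij.
    rewrite (rX t i j (widen_ord (leqnSn _) i) (widen_ord (leqnSn _) j)) //.
    (* [csum_upper] leaves out row 0; here that row is zero, as [m <= p] makes the window start
       after column [k * p.+2]. *)
    have [i0|i0] := posnP i; last first.
      exact: (csum_upper corner_rm k_gt0 corner_qs corner_kq corner_sm).
    rewrite (csumE corner_rm k_gt0 corner_qs) summxE big1 // => b _.
    rewrite (colprod_row0 (adj_wblock s corner_rm t)) //= i0.
    by have := leq_mul (ltn_ord b) (leqnn p.+2); rewrite /s; lia.
  - by apply: eq_propto (compat_lower_diag i cf) => t; rewrite [RHS]mxE leqnn.
  - apply: eq_propto (csum_diag corner_rm k_gt0 corner_qs (widen_ord (leqnSn _) i)) => t.
    by rewrite (rX t i i (widen_ord (leqnSn _) i) (widen_ord (leqnSn _) i)).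
apply: eq_propto diag => t; rewrite /crossterm.
rewrite /lgradY gradY_wminor wgradY_corner mulmx0 mul0mx mulmx0.
by rewrite /trform mulmx0 mxtrace0 addr0.
Qed.

End CornerMinors.

End WindowMinors.

(** * The family as minors of U *)

Section Identification.
Variables (K : numFieldType) (p : nat).

(* Trailing minors of X are minors of the first k block rows of U, whose block
   column k contains only X and zeros. *)
Lemma theta_wminor k m : (0 < k)%N -> (0 < m)%N -> (m <= p)%N ->
  @theta K p.+1 m = @wminor K p k (k * p - m) (k * p.+2 + (p.+1 - m)) m.
Proof.
case: k => // k k0 m0 mp; apply/funext => X; apply/funext => Y.
rewrite /theta /minor /wminor; congr (\det _); apply/matrixP => u v; rewrite mxE.
have kp := leq_mul k0 (leqnn p).
have i_lt : (p - m + u < p)%N by have := ltn_ord u; lia.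
have j_lt : (p.+1 - m + v < p.+2)%N by have := ltn_ord v; lia.
rewrite (@windowE _ p p.+2 k.+1 (k.+1 * p - m) _ m _ _ _ k k.+1
  (Ordinal i_lt) (Ordinal j_lt)).
- rewrite gtn_eqF // eqxx mxE /= ifT; last by have := ltn_ord v; lia.
  by congr mxat; lia.
- by lia.
- by rewrite /= mulSn; lia.
- by rewrite /=; lia.
Qed.

(* Windows into the infinite matrix are taken one block further down and right
   than in U_mx, so that all blocks of index 0 of the adjugate vanish. *)
Lemma U_mx_window X Y m e (u v : 'I_m) (k := (CGk p.+1).+1) :
  (0 < m)%N -> (m <= CGN p.+1)%N -> (e <= 1)%N ->
  mxat (@U_mx K p.+1 X Y) (CGN p.+1 - m + 1 + u) (CGk p.+1 * (p.+1 + 1) - m + 1 + e + v) =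
  window k (k * p - m) (k * p.+2 + e - m) m (calX X : 'M_(p, p.+2)) (calY Y) u v.
Proof.
rewrite -[CGN p.+1]/(CGk p.+1 * p)%N => m0 mN e1.
set c := CGk p.+1 in k mN *.
have sum_const b n d : (b <= n)%N -> (\sum_(i < n | (i < b)%N) d = b * d)%N.
  by move=> bn; rewrite (big_ord_narrow bn) sum_nat_const card_ord.
have sum_const' n d : (\sum_(i < n) d = n * d)%N.
  by rewrite sum_nat_const card_ord.
have cq : (c * p.+2 = c * p + 2 * c)%N by lia.
have lt_row : (c * p - m + u < \sum_(a < c) p)%N.
  by rewrite sum_const'; have := ltn_ord u; lia.
have lt_col : (c * p.+2 - m + e + v < \sum_(b < c.+1) p.+2)%N.
  by rewrite sum_const' mulSn; have := ltn_ord v; lia.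
rewrite (@mxatE _ _ _ _ _ _ (Ordinal lt_row) (Ordinal lt_col)) /=; [|lia|lia].
rewrite mxE.
set a := tagnat.sig1 (Ordinal lt_row); set b := tagnat.sig1 (Ordinal lt_col).
set i := tagnat.sig2 (Ordinal lt_row); set j := tagnat.sig2 (Ordinal lt_col).
(* A flat index of the block matrix is its block offset plus its position in the block. *)
have rowE := tagnat.rect (Ordinal lt_row).
rewrite sum_const ?(ltnW (ltn_ord _)) //= -/a -/i in rowE.
have colE := tagnat.rect (Ordinal lt_col).
rewrite sum_const ?(ltnW (ltn_ord _)) //= -/b -/j in colE.
rewrite (@windowE _ p p.+2 k (k * p - m) _ m _ _ _ a.+1 b.+1 i j).
- by rewrite !eqSS; case: ifP => // _; case: ifP => // _; rewrite mxE.
- by rewrite /k mulSn; lia.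
- by rewrite /k !mulSn; lia.
- by rewrite /k !mulSn; lia.
Qed.

Lemma phi_wminor m (k := (CGk p.+1).+1) : (0 < m)%N -> (m <= CGN p.+1)%N ->
  @phi K p.+1 m = @wminor K p k (k * p - m) (k * p.+2 - m) m.
Proof.
move=> m0 mN; apply/funext => X; apply/funext => Y.
rewrite /phi /minor /wminor; congr (\det _); apply/matrixP => u v; rewrite mxE.
by rewrite -[(k * p.+2)%N]addn0 -U_mx_window // addn0.
Qed.

Lemma psi_wminor m (k := (CGk p.+1).+1) : (0 < m)%N -> (m <= CGN p.+1)%N ->
  @psi K p.+1 m = @wminor K p k (k * p - m) (k * p.+2 + 1 - m) m.
Proof.
move=> m0 mN; apply/funext => X; apply/funext => Y.
rewrite /psi /minor /wminor; congr (\det _); apply/matrixP => u v; rewrite mxE.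
by rewrite -U_mx_window // -!addnA.
Qed.

Let k := (CGk p.+1).+1.

(** The columns of a trailing window end at [k * p.+2] for [phi] and one further for [psi]. *)
Inductive minor_kind (f : dfun K p.+1) : Prop :=
| TrailingMinor r s m of f = wminor k r s m & (r + m = k * p)%N &
    (p.+2 <= s)%N & (k * p.+2 <= s + m <= (k * p.+2).+1)%N
| CornerMinor m of f = wminor k (k * p - m) (k * p.+2 + (p.+1 - m)) m &
    (0 < m <= p)%N.

Lemma family_minor_kind f : (0 < p)%N -> CGfamily f -> minor_kind f.
Proof.
move=> p0; have Nq : (CGN p.+1 <= CGk p.+1 * p.+2)%N.
  by rewrite leq_mul2l leqW ?leqnSn ?orbT.
case=> -[m /andP[m0 mN] ->].
- by right with m; [exact: theta_wminor | rewrite m0].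
- left with (k * p - m)%N (k * p.+2 - m)%N m; first exact: phi_wminor.
  + by rewrite subnK // /k mulSn (leq_trans mN) // leq_addl.
  + by rewrite /k mulSn; lia.
  + by rewrite /k mulSn; lia.
(* With truncated subtraction, [CGN - n + 1 <= CGN] relies on [CGN > 0]. *)
have {}mN : (m <= CGN p.+1)%N.
  move: mN; rewrite /CGM; case: ifP => // _.
  have : (0 < CGN p.+1)%N by rewrite /CGN /CGk addn1 muln_gt0 p0.
  by lia.
left with (k * p - m)%N (k * p.+2 + 1 - m)%N m; first exact: psi_wminor.
+ by rewrite subnK // /k mulSn (leq_trans mN) // leq_addl.
+ by rewrite /k mulSn; lia.
+ by rewrite /k mulSn; lia.
Qed.

Lemma compatible_kind f : minor_kind f -> compatible f.
Proof.
case=> [r s m -> rm qs /andP[sm sm1]|m -> /andP[m0 mp]].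
  by apply: compatible_wminor => //; left.
exact: compatible_corner.
Qed.

Lemma propto_bracketD f g : minor_kind f -> minor_kind g ->
  propto (fun t => uncurried f t * uncurried g t) (fun t => bracketD f g t.1 t.2).
Proof.
move=> kf kg; have [cf cg] := (compatible_kind kf, compatible_kind kg).
have flip : propto (fun t => uncurried g t * uncurried f t)
                   (fun t => bracketD g f t.1 t.2) ->
            propto (fun t => uncurried f t * uncurried g t)
                   (fun t => bracketD f g t.1 t.2).
  case=> w gf; exists (- w) => t.
  by rewrite bracketD_antisym gf mulNr [uncurried f t * _]mulrC.
case: kg cg flip => [r' s' m' gE rm' qs' sm'|m' gE /andP[m0 mp]] cg flip; last first.
  rewrite gE; apply: propto_bracket => //; first by rewrite -gE.
  exact: propto_crossterm_corner.
case: kf cf flip => [r s m fE rm qs sm|m fE /andP[m0 mp]] cf flip; last first.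
  apply: flip; rewrite fE; apply: propto_bracket => //; first by rewrite -fE.
  exact: propto_crossterm_corner.
(* Two trailing windows are always comparable: a smaller size moves the row start down by at least
   1, while the column ends differ by at most 1. Antisymmetry then puts the later window second. *)
have [/andP[rr ss]|nle] := boolP ((r <= r')%N && (s <= s')%N).
  by apply: propto_bracket => //; rewrite fE gE; apply: propto_crossterm_wminor.
apply: flip; apply: propto_bracket => //; rewrite fE gE.
by apply: propto_crossterm_wminor => //; lia.
Qed.

End Identification.

Theorem theorem4p4 (K : numFieldType) (n : nat) (hn : (2 <= n)%N) :
  log_canonical (@CGfamily K n).
Proof.
case: n hn => [//|p] p0 f g Ff Fg.
have [w fg] := propto_bracketD (family_minor_kind p0 Ff) (family_minor_kind p0 Fg).
by exists w => X Y _ _; apply: (fg (X, Y)).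
Qed.
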